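(* For a $T_0$-space $X$ the following conditions are equivalent: (1) $X$ is metrizable; (2) $X$ is a first-countable closed-$\bar G_\delta$ space with a countable locally uniform $\mathsf{cs}^{*}$-netbase; (3) $X$ is a first-countable strong $\sigma$-space with a countable locally quasi-uniform $\mathsf{cs}^*$-netbase; (4) $X$ is a first-countable collectionwise normal $\Sigma$-space with a countable locally uniform $\mathsf{cs}^*$-netbase; (5) $X$ is an $M$-space with a countable locally uniform $\overline{\mathsf{cs}}^{**}$-netbase; (6) $X$ is a $q$-space, a collectionwise normal $\Sigma$-space, and $X$ has a countable locally uniform $\overline{\mathsf{cs}}^{**}$-netbase.
   Context: Regular means: every neighborhood of each point contains a closed neighborhood of that point. A set $C\subset X$ accumulates at $x$ if every neighborhood of $x$ contains infinitely many points of $C$; a sequence accumulates at $x$ if each neighborhood of $x$ contains $x_n$ for infinitely many $n$. Spaces. $X$ is closed-$\bar G_\delta$ if for each closed $F\subset X$ there is a sequence $(W_n)_{n\in\omega}$ of open sets with $F=\bigcap_nW_n=\bigcap_n\overline{W}_n$. A family $\mathcal F$ of subsets of $X$ is discrete if each point has a neighborhood meeting at most one member of $\mathcal F$; strongly discrete if each $F\in\mathcal F$ has an open neighborhood $U_F$ such that $(U_F)_{F\in\mathcal F}$ is discrete; (strongly) $\sigma$-discrete if it is a countable union of (strongly) discrete families. $X$ is collectionwise normal if each discrete family of closed sets is strongly discrete. A network is a family $\mathcal N$ such that for any open $U$ and $x\in U$ there is $N\in\mathcal N$ with $x\in N\subset U$. A strong $\sigma$-space is a regular $T_0$-space with a strongly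 $\sigma$-discrete network. A $\Sigma$-space is a regular $T_0$-space having, for some cover $\mathcal C$ by closed countably compact subspaces, a $\sigma$-discrete family $\mathcal N$ such that for each $C\in\mathcal C$ and open $U\supset C$ there is $N\in\mathcal N$ with $C\subset N\subset U$. An $M$-space is a regular $T_0$-space admitting a sequence $(\mathcal U_n)_{n\in\omega}$ of open covers such that $\mathcal U_{n+1}$ star-refines $\mathcal U_n$ (for each $V\in\mathcal U_{n+1}$ the union of all members of $\mathcal U_{n+1}$ meeting $V$ lies in some member of $\mathcal U_n$) and for every $x\in X$ any sequence $(x_n)_{n\in\omega}$ with $x_n\in\bigcup\{U\in\mathcal U_n:x\in U\}$ for all $n$ has an accumulation point in $X$. $X$ is a $q$-space if at each $x\in X$ there is a sequence $(U_n)$ of neighborhoods of $x$ such that every $(x_n)\in\prod_nU_n$ accumulates at some point of $X$. Netbases. An entourage on $X$ is a subset $E\subset X\times X$ containing the diagonal; $E[x]=\{y:(x,y)\in E\}$, $E^{-1}=\{(y,x):(x,y)\in E\}$, $UV=\{(x,z):\exists y\ (x,y)\in U,\ (y,z)\in V\}$. An entourage base for $X$ is a family $\mathcal B$ of entourages such that (i) for all $B_1,B_2\in\mathcal B$ there is $B_3\in\mathcal B$ with $B_3\subset B_1\cap B_2$; (ii) for every $x$ the family $\{B[x]:B\in\mathcal B\}$ is a neighborhood base at $x$. It is locally uniform (locally quasi-uniform) if for every $x$ and neighborhood $O_x$ of $x$ there is $B\in\mathcal B$ with $BB^{-1}B[x]\subset O_x$ (resp. $BB[x]\subset O_x$). Let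 $\mathcal C$ be a family of subsets of $X$. A family $\mathcal N$ of subsets is a $\mathcal C^*$-network at $x$ if for any neighborhood $O_x$ of $x$ and any $C\in\mathcal C$ accumulating at $x$ there is $N\in\mathcal N$ with $x\in N\subset O_x$ and $N\cap C$ infinite. A $\mathcal C^*$-netbase is a pair $(\mathcal E,\mathcal B)$ with $\mathcal E$ a family of entourages and $\mathcal B$ an entourage base for $X$ such that for every $B\in\mathcal B$, $x\in X$ the family $\{E[x]:E\in\mathcal E,\ E\subset B\}$ is a $\mathcal C^*$-network at $x$. A $\mathcal C^{**}$-netbase is such a pair for which for any $B\in\mathcal B$ and any $C\in\mathcal C$ accumulating at some point of $X$ there are $E\in\mathcal E$, $E\subset B$, and $z\in X$ with $E[z]\cap C$ infinite. A netbase is countable if $\mathcal E$ is countable, and locally (quasi-)uniform if $\mathcal B$ is. $\mathsf{cs}$ is the family of all convergent sequences in $X$, i.e. of infinite sets of the form $\{x_n\}_{n\in\omega}$ with $(x_n)$ a convergent sequence; $\overline{\mathsf{cs}}$ is the family of all countable subsets of $X$ with countably compact closure (a closed set is countably compact if each of its infinite subsets accumulates at some point). *)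

(* Defs.v *)
From HB Require Import structures.
From mathcomp Require Import all_boot all_order all_algebra.
From mathcomp Require Import all_classical all_reals topology.

Set Implicit Arguments.
Unset Strict Implicit.
Unset Printing Implicit Defensive.

Local Open Scope classical_set_scope.

Definition metrizable (R : realType) (T : topologicalType) : Prop :=
  exists (M : metricType R) (f : T -> M) (g : M -> T),
    [/\ cancel f g, cancel g f, continuous f & continuous g].

Definition first_countable (T : topologicalType) : Prop :=
  forall x : T, exists2 B : set (set T), countable B & nbhs x = filter_from B id.

(* "C accumulates at x" *)
Definition clusters_at (T : topologicalType) (C : set T) (x : T) : Prop :=
  forall U : set T, nbhs x U -> infinite_set (U `&` C).

(* Not the same as [clusters_at (range u) x]: it is the set of indices, not of
   values, that has to be infinite. *)
Definition seq_clusters_at (T : topologicalType) (u : nat -> T) (x : T) : Prop :=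
  forall U : set T, nbhs x U -> infinite_set [set n | U (u n)].

Definition closed_countably_compact (T : topologicalType) (C : set T) : Prop :=
  closed C /\
  forall A : set T, A `<=` C -> infinite_set A -> exists x, clusters_at A x.

Definition closed_Gdelta_bar (T : topologicalType) : Prop :=
  forall F : set T, closed F -> exists W : nat -> set T,
    [/\ forall n, open (W n), F = \bigcap_n W n & F = \bigcap_n closure (W n)].

(* Indexed families: a set that occurs at two indices of [D] counts twice.
   A set [N] of subsets of [T] is the family [discrete_family N id]. *)
Definition discrete_family (T : topologicalType) (I : Type) (D : set I)
    (F : I -> set T) : Prop :=
  forall x : T, exists2 O : set T, nbhs x O &
    forall i j, D i -> D j -> O `&` F i !=set0 -> O `&` F j !=set0 -> i = j.

Definition strongly_discrete (T : topologicalType) (N : set (set T)) : Prop :=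
  exists U : set T -> set T,
    (forall F, N F -> open (U F) /\ F `<=` U F) /\ discrete_family N U.

Definition sigma_discrete (T : topologicalType) (N : set (set T)) : Prop :=
  exists2 Ns : nat -> set (set T),
    N = \bigcup_n Ns n & forall n, discrete_family (Ns n) id.

Definition strongly_sigma_discrete (T : topologicalType) (N : set (set T)) : Prop :=
  exists2 Ns : nat -> set (set T),
    N = \bigcup_n Ns n & forall n, strongly_discrete (Ns n).

Definition collectionwise_normal (T : topologicalType) : Prop :=
  forall N : set (set T), (forall F, N F -> closed F) ->
    discrete_family N id -> strongly_discrete N.

Definition is_network (T : topologicalType) (N : set (set T)) : Prop :=
  forall (U : set T) (x : T), open U -> U x ->
    exists2 A, N A & A x /\ A `<=` U.

Definition strong_sigma_space (T : topologicalType) : Prop :=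
  [/\ regular_space T, @kolmogorov_space T &
      exists2 N : set (set T), strongly_sigma_discrete N & is_network N].

Definition Sigma_space (T : topologicalType) : Prop :=
  [/\ regular_space T, @kolmogorov_space T &
      exists Cs N : set (set T),
        [/\ cover Cs id = setT,
            forall C, Cs C -> closed_countably_compact C,
            sigma_discrete N &
            forall C U, Cs C -> open U -> C `<=` U ->
              exists2 A, N A & C `<=` A /\ A `<=` U]].

Definition open_cover (T : topologicalType) (Us : set (set T)) : Prop :=
  (forall U, Us U -> open U) /\ cover Us id = setT.

Definition star_refines (T : Type) (Vs Us : set (set T)) : Prop :=
  forall V, Vs V -> exists2 U, Us U &
    \bigcup_(W in [set W | Vs W /\ W `&` V !=set0]) W `<=` U.

Definition M_space (T : topologicalType) : Prop :=
  [/\ regular_space T, @kolmogorov_space T &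
      exists Us : nat -> set (set T),
        [/\ forall n, open_cover (Us n),
            forall n, star_refines (Us n.+1) (Us n) &
            forall (x : T) (u : nat -> T),
              (forall n, (\bigcup_(U in [set U | Us n U /\ U x]) U) (u n)) ->
              exists y, seq_clusters_at u y]].

Definition q_space (T : topologicalType) : Prop :=
  forall x : T, exists2 U : nat -> set T, forall n, nbhs x (U n) &
    forall u : nat -> T, (forall n, U n (u n)) -> exists y, seq_clusters_at u y.

(* For an entourage [E], the ball E[x] is [xsection E x]. *)
Definition entourage_base (T : topologicalType) (Bs : set (set (T * T))) : Prop :=
  [/\ forall B, Bs B -> diagonal `<=` B,
      forall B1 B2, Bs B1 -> Bs B2 -> exists2 B3, Bs B3 & B3 `<=` B1 `&` B2 &
      forall x : T, nbhs x = filter_from Bs (fun B => xsection B x)].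

(* [V \; U] composes from right to left, i.e. it is the product written U V
   in the netbase literature; the two products below are palindromes, so the
   order is immaterial. *)
Definition locally_uniform (T : topologicalType) (Bs : set (set (T * T))) : Prop :=
  forall (x : T) (O : set T), nbhs x O ->
    exists2 B, Bs B & xsection (B \; (B^-1 \; B))%relation x `<=` O.

Definition locally_quasi_uniform (T : topologicalType)
    (Bs : set (set (T * T))) : Prop :=
  forall (x : T) (O : set T), nbhs x O ->
    exists2 B, Bs B & xsection (B \; B)%relation x `<=` O.

Definition star_network (T : topologicalType) (Cs N : set (set T)) (x : T) : Prop :=
  forall (O C : set T), nbhs x O -> Cs C -> clusters_at C x ->
    exists A, [/\ N A, A x, A `<=` O & infinite_set (A `&` C)].

Definition star_netbase (T : topologicalType) (Cs : set (set T))
    (Es Bs : set (set (T * T))) : Prop :=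
  [/\ forall E, Es E -> diagonal `<=` E,
      entourage_base Bs &
      forall B x, Bs B ->
        star_network Cs [set xsection E x | E in [set E | Es E /\ E `<=` B]] x].

Definition star_star_netbase (T : topologicalType) (Cs : set (set T))
    (Es Bs : set (set (T * T))) : Prop :=
  [/\ forall E, Es E -> diagonal `<=` E,
      entourage_base Bs &
      forall B C, Bs B -> Cs C -> (exists x, clusters_at C x) ->
        exists E z, [/\ Es E, E `<=` B & infinite_set (xsection E z `&` C)]].

Definition convergent_sequences (T : topologicalType) : set (set T) :=
  [set C | infinite_set C /\
    exists (u : nat -> T) (x : T), (u @ \oo --> x) /\ C = range u].

Definition countably_compact_closure (T : topologicalType) : set (set T) :=
  [set C | countable C /\ closed_countably_compact (closure C)].

Definition has_countable_lu_cs_star_netbase (T : topologicalType) : Prop :=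
  exists Es Bs, [/\ star_netbase (@convergent_sequences T) Es Bs,
                    countable Es & locally_uniform Bs].

Definition has_countable_lqu_cs_star_netbase (T : topologicalType) : Prop :=
  exists Es Bs, [/\ star_netbase (@convergent_sequences T) Es Bs,
                    countable Es & locally_quasi_uniform Bs].

Definition has_countable_lu_csbar_star_star_netbase (T : topologicalType) : Prop :=
  exists Es Bs, [/\ star_star_netbase (@countably_compact_closure T) Es Bs,
                    countable Es & locally_uniform Bs].

(* Main.v *)
Require Import Defs.
From HB Require Import structures.
From mathcomp Require Import all_boot all_order all_algebra.
From mathcomp Require Import all_classical all_reals topology urysohn wochoice.
From mathcomp Require Import lra.

Set Implicit Arguments.
Unset Strict Implicit.
Unset Printing Implicit Defensive.

Import Order.TTheory GRing.Theory Num.Theory.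
Import numFieldTopology.Exports.

Local Open Scope classical_set_scope.

(** Each of the conditions yields an open base that is a countable union of
    discrete families; in a regular T0 space such a base gives a metric
    ([metrizable_of_discrete_base]). The base always comes from comparing two
    things.

    The first is what a countable family [Es] of a netbase says about
    neighbourhoods. The balls of its members need not be neighbourhoods; but if
    points have countable bases, then for every [B] of the entourage base and
    every point [x] some finite union of members of [Es] below [B] has a
    neighbourhood of [x] as its ball at [x]: otherwise a sequence converging
    to [x] would escape all these unions, while some member has to catch
    infinitely many of its terms ([cs_star_nbhs]). If the netbase only promises
    a ball about some other point, then [x] is in the closure of this ball, and
    balls meeting it near [x] are still controlled by local uniformity
    ([csbar_star_star_nbhs]). Countably many relations [S k] thus satisfy: every
    neighbourhood of [x] contains [S k [S k [x]]], for some [k] such that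
    [S k [x]] is a neighbourhood of [x] (a [quasi_development]).

    The second is a network with discrete open expansions. If [F] is a member
    of the network with [x] in [F], contained in [S k [x]], and [U] is its
    expansion, then the part of [U] covered by the interiors of the [S k [y]],
    where [y] runs through the points of [F] at which [S k [y]] is a
    neighbourhood, is open, contains [x] and is contained in [S k [S k [x]]];
    these sets form the base ([discrete_base_of_network]).

    A strong sigma-space has such a network by definition. For a collectionwise
    normal Sigma-space and for an M-space one starts from families that only
    separate closed countably compact sets and cuts their members into pieces
    that share a ball with a fixed point. Finitely many pieces suffice, for
    otherwise there would be a sequence with countably compact closure whose
    [k]-th term shares no ball of the first [k] entourages with the earlier
    terms, and the netbase forbids it
    ([expanded_network_of_netbase]). In an M-space the initial families are
    obtained from the star-refining covers by a well-ordering of the points,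
    following Stone ([stone_refinement]). With a network at hand points are
    G-delta, so a regular q-space has countable bases ([q_space_seq_bases]).

    If every closed set is the intersection of a sequence of open sets and also
    of their closures, the base is found without a network: the open set covered
    by the neighbourhood balls of one finite union is completed to a cover of
    the space by the open sets around its complement, and the covers so
    obtained satisfy Moore's criterion, which by Stone's construction again
    gives the base ([moore_discrete_base], [discrete_base_of_Gdelta_bar]). *)

(** * Metrics on the space itself *)

Definition compatible_metric (R : realType) (T : topologicalType)
    (d : T -> T -> R) : Prop :=
  [/\ forall x, d x x = 0%R, forall x y, d x y = 0%R -> x = y,
      forall x y, d x y = d y x,
      forall y x z, (d x z <= d x y + d y z)%R &
      forall x, nbhs x = filter_from [set e | 0 < e]%R
                                     (fun e => [set y | d x y < e]%R)].

Section MetricCopy.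
Context (R : realType) (T : topologicalType) (d : T -> T -> R).
Hypothesis hd : compatible_metric d.

(** An alias of [T]: the topology that [d] generates is declared on it, and must
    not be confused with the one that [T] has already. *)
Definition metric_copy & compatible_metric d : Type := T.
Local Notation M := (metric_copy hd).

HB.instance Definition _ := Choice.on M.

Let d0 (x : M) : d x x = 0%R. Proof. by case: hd. Qed.
Let deq (x y : M) : d x y = 0%R -> x = y. Proof. by case: hd => ? + *; apply. Qed.
Let dC (x y : M) : d x y = d y x. Proof. by case: hd. Qed.
Let dD (y x z : M) : (d x z <= d x y + d y z)%R. Proof. by case: hd. Qed.

HB.instance Definition _ := isMetric.Build R M d0 deq dC dD.

Lemma metrizable_of_compatible_metric : metrizable R T.
Proof.
have nT (x : T) (A : set T) : nbhs (x : M) A <-> nbhs x A.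
  have [_ _ _ _ ->] := hd; rewrite -nbhs_ballE.
  by split=> -[e e0 eA]; exists e => // y; have := eA y; rewrite ballEmdist.
exists M, (fun x : T => x : M), (fun x : M => x : T); split=> // x A Ax.
  exact/nT.
exact/(nT x).
Qed.

End MetricCopy.

Lemma metrizableP (R : realType) (T : topologicalType) :
  metrizable R T <-> exists d : T -> T -> R, compatible_metric d.
Proof.
split=> [[M [f [g [fK gK fc gc]]]]|[d hd]]; last first.
  exact: metrizable_of_compatible_metric hd.
exists (fun x y => mdist (f x) (f y)); split.
- by move=> x; rewrite mdistxx.
- by move=> x y /mdist_positivity /(can_inj fK).
- by move=> x y; rewrite metric_sym.
- by move=> *; exact: metric_triangle.
move=> x; apply/seteqP; split=> [A|A [e /= e0 eA]]; last first.
  have fB : nbhs x (f @^-1` ball (f x) e) by apply: fc; exact: nbhsx_ballx.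
  by apply: filterS fB => y; rewrite /= ballEmdist => ?; exact: eA.
rewrite -{1}(fK x) => /gc; rewrite -nbhs_ballE => -[e /= e0 eA].
by exists e => // y; have := eA (f y); rewrite /= fK ballEmdist.
Qed.

(** * A metric from an equicontinuous separating sequence of families *)

Lemma invS_lt (R : realType) (e : R) : (0 < e -> exists N, N.+1%:R^-1 < e)%R.
Proof.
move=> e0; exists (Num.truncn e^-1).
by rewrite invf_plt ?posrE ?ltr0n// truncnS_gt.
Qed.

Lemma invS_gt0 (R : realType) (n : nat) : (0 < n.+1%:R^-1 :> R)%R.
Proof. by rewrite invr_gt0 ltr0n. Qed.

Section FunctionMetric.
Local Open Scope ring_scope.
Context (R : realType) (T : topologicalType) (I : Type) (f : nat -> I -> T -> R).
Hypothesis f01 : forall j i x, 0 <= f j i x <= 1.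

Definition fun_gaps (x y : T) : set R :=
  [set r | r = 0 \/ exists j i, r = j.+1%:R^-1 * `|f j i x - f j i y|].
Definition fun_dist (x y : T) : R := sup (fun_gaps x y).

Lemma fun_dist_le x y e : 0 <= e ->
  (forall j i, j.+1%:R^-1 * `|f j i x - f j i y| <= e) -> fun_dist x y <= e.
Proof.
move=> e0 fe; apply: ge_sup; first by exists 0; left.
by move=> r [->//|[j [i ->]]]; exact: fe.
Qed.

Lemma fun_gap_le1 j i x y : `|f j i x - f j i y| <= 1.
Proof. have := f01 j i x; have := f01 j i y; rewrite ler_norml; lra. Qed.

Lemma fun_gaps_sup x y : has_sup (fun_gaps x y).
Proof.
split; first by exists 0; left.
exists 1 => r [->//|[j [i ->]]].
rewrite mulr_ile1 ?invr_ge0 ?ler0n//; last exact: fun_gap_le1.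
by rewrite invf_le1 ?ltr0n// ler1n.
Qed.

Lemma fun_dist_ge0 x y : 0 <= fun_dist x y.
Proof. by apply: sup_upper_bound; [exact: fun_gaps_sup|left]. Qed.

Lemma fun_gap_le j i x y : j.+1%:R^-1 * `|f j i x - f j i y| <= fun_dist x y.
Proof. by apply: sup_upper_bound; [exact: fun_gaps_sup|right; exists j, i]. Qed.

Hypothesis fcont : forall j x e, 0 < e ->
  nbhs x [set y | forall i, `|f j i x - f j i y| <= e].
Hypothesis fsep : forall x O, nbhs x O ->
  exists j i, f j i x = 1 /\ forall y, ~ O y -> f j i y = 0.

Lemma fun_dist_nbhs x (e : R) : 0 < e -> nbhs x [set y | fun_dist x y < e].
Proof.
move=> e0; have e20 : 0 < e / 2 by rewrite divr_gt0.
have [N Ne] := invS_lt e20.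
have /filterS : nbhs x [set y | forall j i, (j < N)%N ->
    `|f j i x - f j i y| <= e / 2].
  elim: N {Ne} => [|N IH]; first by apply: filterS filterT => y _ j i.
  apply: filterS2 IH (fcont N x e20) => y yN yS j i.
  by rewrite ltnS leq_eqVlt => /predU1P[->|jN]; [exact: yS|exact: yN].
apply=> y yN /=; apply: (@le_lt_trans _ _ (e / 2)); last by lra.
apply: fun_dist_le => [|j i]; first exact: ltW.
have [jN|Nj] := ltnP j N.
  apply: le_trans (yN j i jN); rewrite ler_piMl// invf_le1 ?ltr0n// ler1n//.
apply: le_trans (ltW Ne).
apply: (@le_trans _ _ (j.+1%:R^-1 * 1)).
  by rewrite ler_wpM2l ?invr_ge0 ?ler0n ?fun_gap_le1.
by rewrite mulr1 lef_pV2 ?posrE ?ltr0n// ler_nat ltnS.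
Qed.

(** The weights 1/(j+1) make the sup-distance of the families [f j] depend, up
    to any given error, on finitely many [j] only; for these, equicontinuity
    makes the balls neighbourhoods, and separation makes them small. *)
Lemma metrizable_of_functions : kolmogorov_space T -> metrizable R T.
Proof.
move=> T0; apply/metrizableP; exists fun_dist.
have dsep x O : nbhs x O ->
    exists2 e, 0 < e & forall y, fun_dist x y < e -> O y.
  move=> /fsep[j [i [fx fO]]]; exists j.+1%:R^-1; first exact: invS_gt0.
  move=> y; apply: contraPP => /fO fy; apply/negP; rewrite -leNgt.
  by have := fun_gap_le j i x y; rewrite fx fy subr0 normr1 mulr1.
have dC x y : fun_dist x y = fun_dist y x.
  rewrite /fun_dist; congr (sup _); apply/seteqP.
  by split=> r [->|[j [i ->]]]; [left|right; exists j, i; rewrite distrC|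
    left|right; exists j, i; rewrite distrC].
split=> //.
- move=> x; apply/eqP; rewrite eq_le fun_dist_ge0 andbT.
  by apply: fun_dist_le => // j i; rewrite subrr normr0 mulr0.
- move=> x y dxy; apply/eqP; apply: contraT => /T0[A].
  by rewrite !inE => -[] [/dsep[e e0 eA]] []; apply: eA; rewrite ?dxy 1?dC ?dxy.
- move=> y x z; apply: fun_dist_le => [|j i].
    by rewrite addr_ge0 ?fun_dist_ge0.
  apply: le_trans (lerD (fun_gap_le j i x y) (fun_gap_le j i y z)).
  by rewrite -mulrDr ler_wpM2l ?ler_distD// invr_ge0 ler0n.
move=> x; apply/seteqP; split=> [O /dsep[e e0 eO]|O [e /= e0 eO]].
  by exists e.
exact: filterS eO (fun_dist_nbhs x e0).
Qed.

End FunctionMetric.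

(** * Spaces with a sigma-discrete open base *)

Lemma setI_eq0_in T (A B : set T) x : A `&` B = set0 -> A x -> B x -> False.
Proof. by move=> AB Ax Bx; have : (A `&` B) x; [|rewrite AB]. Qed.

Lemma sub_discrete_family (T : topologicalType) (I : Type) (D E : set I)
    (F G : I -> set T) : D `<=` E -> (forall i, D i -> F i `<=` G i) ->
  discrete_family E G -> discrete_family D F.
Proof.
move=> DE FG dG x; have [O Ox OG] := dG x; exists O => // i j Di Dj OF OF'.
by apply: OG; [exact: DE|exact: DE|apply: subset_nonempty OF; apply: setIS;
  exact: FG|apply: subset_nonempty OF'; apply: setIS; exact: FG].
Qed.

(** Near any given point a discrete family consists of at most one set. *)
Lemma closure_bigcup_discrete (T : topologicalType) (I : Type) (D : set I)
    (F : I -> set T) : discrete_family D F ->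
  closure (\bigcup_(i in D) F i) `<=` \bigcup_(i in D) closure (F i).
Proof.
move=> dF x clx; have [O Ox OF] := dF x.
have [y [[i Di Fiy] Oy]] := clx _ Ox.
exists i => // B Bx; have [z [[k Dk Fkz] [Bz Oz]]] := clx _ (filterI Bx Ox).
exists z; split=> //; suff -> : i = k by [].
by apply: OF => //; [exists y|exists z].
Qed.

(** Empty sets are harmless in such indexed families, so that a level may be
    indexed by a type larger than needed; levels range over a
    [countType] so that pairs and finite sequences can index them directly. *)
Definition discrete_base (T : topologicalType) (J : countType) (I : Type)
    (G : J -> I -> set T) : Prop :=
  [/\ forall j i, open (G j i), forall j, discrete_family setT (G j) &
      forall x O, nbhs x O -> exists j i, G j i x /\ G j i `<=` O].

Lemma discrete_base_nat (T : topologicalType) (J : countType) (I : Type)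
    (G : J -> I -> set T) : discrete_base G ->
  exists H : nat -> I -> set T, discrete_base H.
Proof.
case=> oG dG bG.
exists (fun n i => if unpickle n is Some j then G j i else set0); split.
- by move=> n i; case: unpickle => [j|]; [exact: oG|exact: open0].
- move=> n; case: unpickle => [j|]; first exact: dG.
  by move=> x; exists setT => [|i j _ _ [y []]//]; exact: filterT.
- move=> x O /bG[j [i Gji]]; exists (pickle j), i; rewrite pickleK//.
Qed.

(** Shrinking each set of one sequence by the closures of the earlier sets of
    the other makes the two sequences disjoint without uncovering [A] or [B]. *)
Lemma separate_by_sequences (T : topologicalType) (A B : set T)
    (U V : nat -> set T) :
  (forall n, open (U n)) -> (forall n, open (V n)) ->
  A `<=` \bigcup_n U n -> B `<=` \bigcup_n V n ->
  (forall n, closure (U n) `&` B = set0) ->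
  (forall n, closure (V n) `&` A = set0) ->
  exists U' V', [/\ open U', open V', A `<=` U', B `<=` V' & U' `&` V' = set0].
Proof.
pose cut (P Q : nat -> set T) n := P n `\` \bigcup_(k in `I_n.+1) closure (Q k).
have open_cut P Q n : (forall n, open (P n)) -> open (cut P Q n).
  move=> oP; rewrite /cut setDE; apply: openI; first exact: oP.
  apply: closed_openC.
  by apply: closed_bigcup => [|k _]; [exact: finite_II|exact: closed_closure].
have sub_cut P Q C : C `<=` \bigcup_n P n ->
    (forall n, closure (Q n) `&` C = set0) -> C `<=` \bigcup_n cut P Q n.
  move=> CP QC x Cx; have [n _ Pn] := CP x Cx; exists n => //; split=> //.
  by move=> [k _ Qk]; exact: setI_eq0_in (QC k) Qk Cx.
have sub_closure (P : nat -> set T) n : P n `<=` closure (P n) by exact: subset_closure.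
move=> oU oV AU BV UB VA.
exists (\bigcup_n cut U V n), (\bigcup_n cut V U n); split.
- by apply: bigcup_open => n _; exact: open_cut.
- by apply: bigcup_open => n _; exact: open_cut.
- exact: sub_cut.
- exact: sub_cut.
apply/seteqP; split=> // x [[n _ [Un nV]] [m _ [Vm nU]]].
have [nm|mn] := leqP n m.
- by apply: nU; exists n => //; exact: sub_closure.
- by apply: nV; exists m; [exact: ltnW|exact: sub_closure].
Qed.

Section DiscreteBase.
Context (R : realType) (T : topologicalType) (I : Type) (G : nat -> I -> set T).
Hypotheses (hG : discrete_base G) (regT : regular_space T).

(** As for regular Lindelof spaces: the sets of a level whose closure misses
    [B] have a union whose closure misses [B], so each of two disjoint closed
    sets is covered by countably many open sets with closure off the other. *)
Lemma discrete_base_normal : normal_space T.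
Proof.
have [oG dG bG] := hG.
pose U (B : set T) n := \bigcup_(i in [set i | closure (G n i) `&` B = set0]) G n i.
have oU B n : open (U B n) by apply: bigcup_open => i _; exact: oG.
have UB B n : closure (U B n) `&` B = set0.
  apply/seteqP; split=> // x [+ Bx] => /closure_bigcup_discrete.
  case=> [|i /= GB Gx]; last exact: setI_eq0_in GB Gx Bx.
  by apply: sub_discrete_family (dG n) => // i _.
have AU A B : closed B -> A `&` B = set0 -> A `<=` \bigcup_n U B n.
  move=> cB AB x Ax; have [V Vx VB] : filter_from (nbhs x) closure (~` B).
    apply: regT; apply: open_nbhs_nbhs; split; first exact: closed_openC.
    by move=> Bx; exact: setI_eq0_in AB Ax Bx.
  have [n [i [Gx GV]]] := bG x V Vx; exists n => //; exists i => //=.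
  by apply/seteqP; split=> // y [/(closureS GV)/VB].
apply/(@normal_openP R) => A B cA cB AB.
apply: (@separate_by_sequences _ A B (U B) (U A)) => //; apply: AU => //.
by rewrite setIC.
Qed.

(** For levels [n] and [m], a Urysohn function is taken that is 1 on the sets of
    level [m] whose closure is inside a set of level [n], and 0 outside level
    [n]; it is then cut into one function per set of level [n]. Discreteness of
    level [n] makes the pieces equicontinuous. *)
Lemma metrizable_of_discrete_base : kolmogorov_space T -> metrizable R T.
Proof.
have [oG dG bG] := hG => T0.
pose W n := \bigcup_i G n i.
pose K n m := closure
  (\bigcup_(i' in [set i' | exists i, closure (G m i') `<=` G n i]) G m i').
have KW n m : K n m `<=` W n.
  move=> x /closure_bigcup_discrete[|i' [i mn] Gx]; last by exists i => //; exact: mn.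
  by apply: sub_discrete_family (dG m) => // i _.
have /choice[f fP] (nm : nat * nat) : exists f : T -> R, [/\ continuous f,
    range f `<=` `[0%R, 1%R]%classic, f @` (~` W nm.1) `<=` [set 0%R] &
    f @` K nm.1 nm.2 `<=` [set 1%R]].
  apply/uniform_separatorP.
  apply: (normal_separatorP (R := R)).1; first exact: discrete_base_normal.
  - by apply: open_closedC; apply: bigcup_open => i _; exact: oG.
  - exact: closed_closure.
  - by apply/seteqP; split=> // x [nW /KW].
pose g (j : nat) i (x : T) : R :=
  if unpickle j is Some nm then if `[< G nm.1 i x >] then f nm x else 0%R else 0%R.
apply: (@metrizable_of_functions R T I g) => //.
- move=> j i x; rewrite /g; case: unpickle => [nm|]; last by rewrite lexx ler01.
  case: ifP => _; last by rewrite lexx ler01.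
  have [_ f01 _ _] := fP nm.
  by have := f01 (f nm x); rewrite /= in_itv/=; apply; exists x.
- move=> j x e e0; rewrite /g; case: unpickle => [[n m]|]; last first.
    by apply: filterS filterT => y _ i; rewrite subrr normr0 ltW.
  have [cf _ f0 _] := fP (n, m); rewrite /=.
  have fx : nbhs x [set y | `|f (n, m) x - f (n, m) y| <= e]%R.
    have fB : nbhs x (f (n, m) @^-1` ball (f (n, m) x) e).
      by apply: cf; exact: nbhsx_ballx.
    by apply: filterS fB => y /ltW.
  have [[i _ Gix]|nWx] := pselect (W n x).
    have [O Ox OG] := dG n x; have Oxx := nbhs_singleton Ox.
    have Gx : nbhs x (G n i) by apply: open_nbhs_nbhs; split; [exact: oG|].
    apply: filterS3 Ox Gx fx => y Oy Giy fy k.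
    case: asboolP => [Gkx|nGkx]; case: asboolP => [Gky|nGky] //.
    - suff ik : i = k by case: nGky; rewrite -ik.
      by apply: OG => //; exists x.
    - suff ik : i = k by case: nGkx; rewrite -ik.
      by apply: OG => //; [exists y|exists y].
    - by rewrite subrr normr0 ltW.
  (* outside level [n] all pieces vanish at [x], and near [x] they are at most
     [f], which is close to 0 *)
  have fx0 : f (n, m) x = 0%R by apply: f0; exists x.
  apply: filterS fx => y; rewrite fx0 => fy k; rewrite asboolF; last first.
    by move=> Gkx; apply: nWx; exists k.
  by case: ifP => // _; rewrite subrr normr0 ltW.
move=> x O /bG[n [i [Gx GO]]].
have [V Vx VG] : filter_from (nbhs x) closure (G n i).
  by apply: regT; apply: open_nbhs_nbhs; split; [exact: oG|].
have [m [i' [G'x G'V]]] := bG x V Vx.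
exists (pickle (n, m)), i; rewrite /g pickleK/=; split.
  rewrite asboolT//; have [_ _ _ f1] := fP (n, m); apply: f1; exists x => //.
  apply: subset_closure; exists i' => //=; exists i.
  exact: subset_trans (closureS G'V) VG.
by move=> y nOy; rewrite asboolF// => /GO.
Qed.
End DiscreteBase.

(** * Stone's construction and Moore's criterion *)

(** Sharing a member of an open cover is such a relation, and it stands for the
    cover in what follows. *)
Definition near_diagonal (T : topologicalType) (S : T -> T -> Prop) : Prop :=
  forall p : T, exists2 W, nbhs p W & forall q r, W q -> W r -> S q r.

Lemma near_diagonal_refl (T : topologicalType) (S : T -> T -> Prop) (x : T) :
  near_diagonal S -> S x x.
Proof. by move=> /(_ x)[W /nbhs_singleton Wx]; apply. Qed.

Lemma near_diagonal_nbhs (T : topologicalType) (S : T -> T -> Prop) (x : T) :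
  near_diagonal S -> nbhs x (S x).
Proof.
move=> /(_ x)[W Wx WS]; apply: filterS (Wx) => y Wy.
by apply: WS => //; exact: nbhs_singleton.
Qed.

Lemma well_order_antisym (I : eqType) (le : rel I) : well_order le ->
  (forall i, le i i) /\ (forall i j, le i j -> le j i -> i = j).
Proof.
move=> wo; have lexx i : le i i.
  have [|k [[+ lek] _]] := wo [pred u | u == i]; first by exists i; rewrite inE eqxx.
  by rewrite inE => /eqP ki; rewrite -{1}ki; apply: lek; rewrite inE.
split=> // i j ij ji.
have [|k [_ uk]] := wo [pred u | (u == i) || (u == j)].
  by exists i; rewrite inE eqxx.
have <- : k = i.
  apply: uk; split; first by rewrite inE eqxx.
  by move=> u; rewrite inE => /orP[] /eqP ->.
apply: uk; split; first by rewrite inE eqxx orbT.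
by move=> u; rewrite inE => /orP[] /eqP ->.
Qed.

Section Stone.
Context (T : topologicalType) (K : countType) (I : eqType).
Context (S : K -> T -> T -> Prop) (O : I -> set T).
Hypothesis Sdiag : forall k, near_diagonal (S k).
Hypothesis Ssym : forall k x y, S k x y -> S k y x.
Hypothesis SO : forall i x, O i x -> exists k m,
  nbhs x [set v | forall q, S m v q -> forall r, S k q r -> O i r].

(** The points of level [(k, m)] in [O i] are those whose [S m]-neighbours have
    all their [S k]-neighbours in [O i]; [G] keeps among them the ones that are
    [S k]-related to a point [x] for which [i] is the first index with [x] in
    [O i]. If [S m]-related points [a] and [b] are kept for [s] and [t], going
    from [b] through [a] to the point [x] of [a] puts [x] in [O t], so [s] is
    not after [t]; by symmetry [s] is [t]. Hence the level is discrete. *)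
Lemma stone_refinement : exists G : K * K -> I -> set T,
  [/\ forall j i, open (G j i), forall j, discrete_family setT (G j),
      forall j i, G j i `<=` O i &
      forall i x, O i x -> exists j i, G j i x].
Proof.
have [le wo] := well_ordering_principle I.
have [_ le_anti] := well_order_antisym wo.
pose core (j : K * K) i := [set p |
  (forall q, S j.2 p q -> forall r, S j.1 q r -> O i r) /\
  exists x, [/\ O i x, forall t, O t x -> le i t & S j.1 x p]].
exists (fun j i => interior (core j i)); split.
- by move=> j i; exact: open_interior.
- move=> [k m] p; have [W Wp WS] := Sdiag m p; exists W => // s t _ _.
  case=> [a [Wa /interior_subset/=[Qa [x [sx minx xa]]]]].
  case=> [b [Wb /interior_subset/=[Qb [y [ty miny yb]]]]].
  apply: le_anti.
    by apply: minx; apply: Qb (WS b a Wb Wa) _ _; exact: Ssym.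
  by apply: miny; apply: Qa (WS a b Wa Wb) _ _; exact: Ssym.
- move=> j i p /interior_subset[Qp _].
  by apply: Qp (near_diagonal_refl p (Sdiag _)) _ (near_diagonal_refl p (Sdiag _)).
move=> i0 x Oi0.
pose A : {pred I} := fun i => `[< O i x >].
have AP i : reflect (O i x) (i \in A) by exact: asboolP.
have [|i [[/AP Oix ilb] _]] := wo A; first by exists i0; exact/AP.
have [k [m Q]] := SO Oix; exists (k, m), i.
apply: filterS2 Q (near_diagonal_nbhs x (Sdiag k)) => v Qv xv; split=> //.
by exists x; split=> // t Ot; exact/ilb/AP.
Qed.

End Stone.

(** Stone's construction is applied, for each [n], to a family of open sets
    small enough for any two points of one of them to be [S n]-related. *)
Lemma moore_discrete_base (T : topologicalType) (K : countType)
    (S : K -> T -> T -> Prop) :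
  (forall k, near_diagonal (S k)) -> (forall k x y, S k x y -> S k y x) ->
  (forall (x : T) O, nbhs x O ->
     exists k, nbhs x [set v | forall q, S k v q -> O q]) ->
  exists (J : countType) (I : Type) (G : J -> I -> set T), discrete_base G.
Proof.
move=> Sdiag Ssym Sdev.
have Wex (k : K) (p : T) : exists W : set T,
    [/\ open W, W p & forall q r, W q -> W r -> S k q r].
  have [W Wp WS] := Sdiag k p; exists (interior W); split=> //.
    exact: open_interior.
  by move=> q r /interior_subset ? /interior_subset ?; exact: WS.
have /choice[W WP] (kp : K * T) := Wex kp.1 kp.2.
have /choice[G GP] (n : K) : exists G : K * K -> T -> set T,
    [/\ forall j i, open (G j i), forall j, discrete_family setT (G j),
      forall j i, G j i `<=` W (n, i) & forall x, exists j i, G j i x].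
  have [|G [oG dG GW cG]] := @stone_refinement T K T S (fun p => W (n, p)) Sdiag Ssym.
    move=> i x Wx; have [oW _ _] := WP (n, i).
    have [k kW] := Sdev x _ (open_nbhs_nbhs (conj oW Wx)).
    have [m mk] := Sdev x _ kW; exists k, m.
    by apply: filterS mk => v Hv q /Hv.
  exists G; split=> // x; have [_ Wx _] := WP (n, x).
  exact: cG Wx.
exists (K * (K * K))%type, T, (fun j => G j.1 j.2); split.
- by move=> [n j] i; have [] := GP n.
- by move=> [n j]; have [] := GP n.
move=> x O Ox; have [n nO] := Sdev x O Ox.
have [_ _ GW cG] := GP n; have [j [i Gx]] := cG x.
exists (n, j), i; split=> // y Gy; apply: (nbhs_singleton nO).
by have [_ _] := WP (n, i); apply; [exact: GW Gx|exact: GW Gy].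
Qed.

(** * Sequences in regular T0 spaces *)

Lemma infinite_nat_ge (A : set nat) N : infinite_set A ->
  exists2 n, (N <= n)%N & A n.
Proof.
move=> iA; apply: contrapT => nA; apply: iA.
apply: (sub_finite_set _ (finite_II N)) => n An /=.
by rewrite ltnNge; apply/negP => Nn; apply: nA; exists n.
Qed.

Section Regular.
Context (T : topologicalType).
Hypotheses (regT : regular_space T) (T0 : @kolmogorov_space T).

Lemma regular_shrink (x : T) O : nbhs x O -> exists2 V, nbhs x V & closure V `<=` O.
Proof. exact: regT. Qed.

Lemma regular_separate (x y : T) : x <> y -> exists2 V, nbhs x V & ~ closure V y.
Proof.
move=> /eqP /T0[A]; rewrite !inE => -[] [].
  by move=> /regular_shrink[V Vx VA] nAy; exists V => // /VA.
move=> /regular_shrink[V Vy VA] nAx; exists (~` closure V).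
  apply: open_nbhs_nbhs; split; first exact/closed_openC/closed_closure.
  by move=> /VA.
move=> /(_ V Vy)[z [nVz Vz]]; apply: nVz; exact: subset_closure.
Qed.

Lemma regular_T1 : @accessible_space T.
Proof.
move=> x y /eqP /regular_separate[V Vx nVy]; exists (interior V).
split; rewrite ?inE//; first exact: open_interior.
by move=> /interior_subset Vy; apply: nVy; exact: subset_closure.
Qed.

Lemma nbhs_avoid_finite (x : T) (A : set T) : finite_set A -> ~ A x ->
  nbhs x (~` A).
Proof.
move=> fA nAx; apply: open_nbhs_nbhs; split=> //; apply: closed_openC.
exact: accessible_finite_set_closed.1 regular_T1 _ fA.
Qed.

Lemma closed_nbhs (C : set T) (x : T) : closed C -> ~ C x -> nbhs x (~` C).
Proof. by move=> cC nCx; apply: open_nbhs_nbhs; split=> //; exact: closed_openC. Qed.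

(** Adding to [C] a sequence [u] that converges to [C] as a whole leaves it
    countably compact: a subset of the range without cluster points could be
    removed from a neighbourhood of [C], so it would be finite. *)
Section SequenceNearCompact.
Context (C : set T) (u : nat -> T).
Hypotheses (ccC : closed_countably_compact C)
  (uC : forall O, open O -> C `<=` O -> exists N, forall n, (N <= n)%N -> O (u n)).

Lemma near_compact_clusters (A : set T) : A `<=` C `|` range u ->
  infinite_set A -> exists x, clusters_at A x.
Proof.
move=> Au iA; have [fAC|iAC] := pselect (finite_set (A `&` C)); last first.
  have [x xA] := ccC.2 _ (@subIsetr _ A C) iAC; exists x => O Ox.
  by apply: sub_infinite_set (xA O Ox) => y [Oy [Ay _]].
apply: contrapT => nA; apply: iA; rewrite -(setUIDK A C) finite_setU.
split=> //.
have [N uN] : exists N, forall n, (N <= n)%N -> interior (~` (A `\` C)) (u n).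
  apply: uC; first exact: open_interior.
  move=> p Cp; have [O Op fO] : exists2 O, nbhs p O & finite_set (O `&` A).
    apply: contrapT => nO; apply: nA; exists p => O Op fO; apply: nO.
    by exists O.
  have fOC : finite_set ((O `&` A) `\` C) by exact: finite_setD.
  have nOC : ~ ((O `&` A) `\` C) p by case.
  apply: filterS2 Op (nbhs_avoid_finite fOC nOC) => v Ov nv [Av nCv].
  exact: nv.
apply: (sub_finite_set (B := u @` `I_N)); last exact/finite_image/finite_II.
move=> y [Ay nCy]; have [//|[n _ un]] := Au y Ay; exists n => //=.
rewrite ltnNge; apply/negP => /uN /interior_subset; apply; rewrite un.
by split.
Qed.

Lemma near_compact_closure : closure (range u) `<=` C `|` range u.
Proof.
move=> y cly; apply: contrapT => /not_orP[nCy nuy].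
have [V Vy VC] := regular_shrink (closed_nbhs ccC.1 nCy).
have [N uN] : exists N, forall n, (N <= n)%N -> (~` closure V) (u n).
  apply: uC; first exact/closed_openC/closed_closure.
  by move=> x Cx /VC.
have [|z [[n _ <-] [Vn nun]]] := cly (V `&` ~` (u @` `I_N)).
  apply: filterI Vy _; apply: nbhs_avoid_finite.
    exact/finite_image/finite_II.
  by move=> [n _ un]; apply: nuy; exists n.
have [nN|Nn] := ltnP n N; first by apply: nun; exists n.
by apply: (uN n Nn); exact: subset_closure.
Qed.

Lemma near_compact_range : countably_compact_closure (range u).
Proof.
split; first exact/card_image_le.
split; first exact: closed_closure.
move=> A Au; apply: near_compact_clusters.
exact: subset_trans Au near_compact_closure.
Qed.

End SequenceNearCompact.

End Regular.

(** The tail form ([m >= n]) dispenses with decreasing bases. *)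
Definition seq_bases (T : topologicalType) : Prop :=
  forall x : T, exists2 V : nat -> set T, forall n, nbhs x (V n) &
    forall O, nbhs x O -> exists n, forall m, (n <= m)%N -> V m `<=` O.

Lemma countable_enum U (x0 : U) (A : set U) : countable A ->
  exists e : nat -> U, A `<=` range e.
Proof.
move=> /pfcard_geP[->|[e]]; first by exists (fun=> x0).
by exists e; rewrite (image_eq e).
Qed.

Lemma first_countable_seq_bases (T : topologicalType) :
  first_countable T -> seq_bases T.
Proof.
move=> fc x; have [B cB nB] := fc x.
have [e eB] := countable_enum setT cB.
exists (fun n => \bigcap_(i in [set i | (i < n)%N /\ B (e i)]) e i).
  elim=> [|n IH].
    by apply: filterS filterT => y _ i [].
  have [Bn|nBn] := pselect (B (e n)).
    have xe : nbhs x (e n) by rewrite nB; exists (e n).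
    apply: filterS2 IH xe => y Hy yn i [/=].
    by rewrite ltnS leq_eqVlt => /predU1P[->//|lin Bi]; exact: Hy.
  apply: filterS IH => y Hy i [/=].
  by rewrite ltnS leq_eqVlt => /predU1P[->//|lin Bi]; exact: Hy.
move=> O; rewrite nB => -[W BW WO].
have [k _ ek] := eB W BW; exists k.+1 => m km y Hy.
by apply: WO; rewrite -ek; apply: Hy; rewrite /= ek.
Qed.

(** * Networks with discrete open expansions *)

Definition discretely_expanded (T : topologicalType) (J : countType) (I : Type)
    (F U : J -> I -> set T) : Prop :=
  [/\ forall j i, open (U j i), forall j i, F j i `<=` U j i &
      forall j, discrete_family setT (U j)].

Definition indexed_network (T : topologicalType) (J : countType) (I : Type)
    (F : J -> I -> set T) : Prop :=
  forall (x : T) O, nbhs x O -> exists j i, F j i x /\ F j i `<=` O.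

Definition has_expanded_network (T : topologicalType) : Prop :=
  exists (J : countType) (I : Type) (F U : J -> I -> set T),
    discretely_expanded F U /\ indexed_network F.

(** Removing from the space, level by level, the closures of the members that
    do not have [x] in their closure leaves countably many neighbourhoods [W n] of
    [x] whose intersection is this single point. Shrinking them by regularity
    inside the q-space sequence gives a base: points [u n] of the [n]-th set
    outside a fixed neighbourhood would cluster, but only at [x]. *)
Lemma q_space_seq_bases (T : topologicalType) :
  regular_space T -> @kolmogorov_space T -> has_expanded_network T ->
  q_space T -> seq_bases T.
Proof.
move=> regT T0 [J [I [F [U [[oU FU dU] nF]]]]] qT x.
have dF j : discrete_family setT (F j).
  exact: sub_discrete_family (dU j).
pose W n : set T := if unpickle n is Some j then
  ~` closure (\bigcup_(i in [set i | ~ closure (F j i) x]) F j i) else setT.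
have Wx n : nbhs x (W n).
  rewrite /W; case: unpickle => [j|]; last exact: filterT.
  apply: closed_nbhs; first exact: closed_closure.
  move=> /closure_bigcup_discrete[|i nx //].
  by apply: sub_discrete_family (dF j) => // i _.
have W1 y : (forall n, W n y) -> y = x.
  move=> Wy; apply: contrapT => /(regular_separate regT T0)[V Vy nVx].
  have [j [i [Fy FV]]] := nF y V Vy; have := Wy (pickle j); rewrite /W pickleK.
  apply; apply: subset_closure; exists i => //=.
  by move=> /(closureS FV).
have [Q Qx Qacc] := qT x.
have /choice[s sP] (O : set T) : exists V, nbhs x O -> nbhs x V /\ closure V `<=` O.
  have [Ox|nOx] := pselect (nbhs x O); last by exists set0.
  by have [V Vx VO] := regular_shrink regT Ox; exists V.
pose fix V n := if n is m.+1 then s (V m `&` (W m `&` Q m)) else setT.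
have Vx n : nbhs x (V n).
  elim: n => [|n IH]; first exact: filterT.
  by apply: (sP _ _).1; apply: filterI => //; apply: filterI.
have VS n : closure (V n.+1) `<=` V n `&` (W n `&` Q n).
  by apply: (sP _ _).2; apply: filterI => //; apply: filterI.
have Vdec n m : (n <= m)%N -> V m `<=` V n.
  move=> /subnK <-; elim: (m - n)%N => // k IH y Vy.
  by apply: IH; apply: (VS _ _ _).1; exact: subset_closure.
exists V => // O Ox; apply: contrapT => nVO.
have /choice[u uP] n : exists y, V n.+1 y /\ ~ O y.
  apply: contrapT => nex; apply: nVO; exists n.+1 => m nm y /(Vdec _ _ nm) Vy.
  by apply: contrapT => nOy; apply: nex; exists y.
have [|y uy] := Qacc u.
  by move=> n; have /subset_closure/VS[_ []] := (uP n).1.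
have clV n : closure (V n) y.
  move=> B By; have [m nm Bm] := infinite_nat_ge n (uy B By).
  exists (u m); split=> //; apply: (Vdec n m.+1); first exact: leqW.
  exact: (uP m).1.
have yx : y = x by apply: W1 => n; have [_ []] := VS n y (clV n.+1).
rewrite -yx in Ox; have [n _ Om] := infinite_nat_ge 0 (uy O Ox).
exact: (uP n).2.
Qed.

(** For given [k], the ball [S k x] need be a neighbourhood of [x] for some of the
    points [x] only; this is what makes it weaker than a development. *)
Definition quasi_development (T : topologicalType) (K : Type)
    (S : K -> T -> T -> Prop) : Prop :=
  forall (x : T) O, nbhs x O -> exists k, nbhs x (S k x) /\
    forall y z, S k x y -> S k y z -> O z.

Lemma discrete_base_of_network (T : topologicalType) (K : countType)
    (S : K -> T -> T -> Prop) :
  has_expanded_network T -> quasi_development S ->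
  exists (J : countType) (I : Type) (G : J -> I -> set T), discrete_base G.
Proof.
move=> [J [I [F [U [[oU FU dU] nF]]]]] qS.
pose N k := [set y | nbhs y (S k y)].
pose G (jk : J * K) i :=
  U jk.1 i `&` \bigcup_(y in F jk.1 i `&` N jk.2) interior (S jk.2 y).
exists (J * K)%type, I, G; split.
- move=> [j k] i; apply: openI; first exact: oU.
  by apply: bigcup_open => y _; exact: open_interior.
- by move=> [j k]; apply: sub_discrete_family (dU j) => // i _; exact: subIsetl.
move=> x O Ox; have [k [Nx SO]] := qS x O Ox.
have [j [i [Fx FS]]] := nF x _ Nx; exists (j, k), i; split.
  by split; [exact: FU|exists x].
by move=> z [_ [y [Fy Ny] /interior_subset yz]]; apply: SO yz; exact: FS.
Qed.

(** * Finite unions of entourages and finite meets of families *)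

Section EnumeratedEntourages.
Context (T : topologicalType) (e : nat -> set (T * T)).

(** The diagonal is added to keep the empty union reflexive, as [Es] may be empty
    when the space is discrete. *)
Definition fin_union (t : seq nat) (x y : T) : Prop :=
  x = y \/ exists2 n, n \in t & e n (x, y).

Definition initial_below (B : set (T * T)) (k : nat) : seq nat :=
  [seq n <- iota 0 k | `[< e n `<=` B >]].

Lemma fin_union_below B k x y : diagonal `<=` B ->
  fin_union (initial_below B k) x y -> B (x, y).
Proof.
move=> dB [->|[n]]; first exact: dB.
by rewrite mem_filter => /andP[/asboolP + _]; apply.
Qed.

Lemma fin_union_initial B k n x y : (n < k)%N -> e n `<=` B -> e n (x, y) ->
  fin_union (initial_below B k) x y.
Proof.
move=> nk enB exy; right; exists n => //.
by rewrite mem_filter mem_iota/= add0n nk andbT; apply/asboolP.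
Qed.

End EnumeratedEntourages.

Lemma infinite_range_inj U (u : nat -> U) : injective u -> infinite_set (range u).
Proof.
move=> uI; apply/infiniteP.
have : (range u #= [set: nat])%card by apply: inj_card_eq => x y _ _ /uI.
by rewrite card_eq_le => /andP[].
Qed.

Lemma infinite_indices U (u : nat -> U) (A : set U) :
  infinite_set (A `&` range u) -> infinite_set [set n | A (u n)].
Proof.
move=> iA fA; apply: iA; apply: sub_finite_set (finite_image u fA).
by move=> y [Ay [n _ uy]]; exists n => //; rewrite /= uy.
Qed.

Lemma dependent_sequence (U : eqType) (P : nat -> seq U -> U -> Prop) :
  (forall k D, exists y, P k D y) ->
  exists u : nat -> U, forall k, exists2 D : seq U,
    P k D (u k) & forall i, (i < k)%N -> u i \in D.
Proof.
move=> Pex; have /choice[h hP] (kD : nat * seq U) := Pex kD.1 kD.2.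
pose fix l k := if k is n.+1 then rcons (l n) (h (n, l n)) else [::].
exists (fun k => h (k, l k)) => k; exists (l k); first exact: (hP (k, l k)).
elim: k => // k IH i; rewrite ltnS leq_eqVlt mem_rcons inE.
by case/predU1P=> [->|/IH ->]; rewrite ?eqxx ?orbT.
Qed.

Lemma nat_injective U (u : nat -> U) :
  (forall i k, (i < k)%N -> u k <> u i) -> injective u.
Proof.
by move=> ui i k uik; apply/eqP; case: ltngtP => // /ui; rewrite uik.
Qed.

Lemma infinite_injection (U : choiceType) (A : set U) : infinite_set A ->
  exists2 u : nat -> U, injective u & forall n, A (u n).
Proof.
move=> iA.
have [k D|u uP] := @dependent_sequence U (fun _ D y => A y /\ y \notin D).
  apply: contrapT => nex; apply: iA; apply: sub_finite_set (finite_seq D) => y Ay.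
  by apply: contrapT => /negP nD; apply: nex; exists y.
exists u => [|n]; last by have [D []] := uP n.
apply: nat_injective => i k ik uki; have [D [_ /negP nD] uD] := uP k.
by apply: nD; rewrite uki; exact: uD.
Qed.

(** Meets of [size s] sets, one from each of the levels listed in [s], are indexed
    by the sequence of their factors; for fixed [s] they form a discrete family
    because each level does. *)
Section MeetFamily.
Context (T : topologicalType) (J : countType) (I : Type).

Fixpoint meet_family (F : J -> I -> set T) (s : seq J) (g : seq I) : set T :=
  match s, g with
  | [::], [::] => setT
  | j :: s', i :: g' => F j i `&` meet_family F s' g'
  | _, _ => set0
  end.

Lemma meet_family_expanded (F U : J -> I -> set T) :
  discretely_expanded F U ->
  [/\ forall s g, open (meet_family U s g),
      forall s g, meet_family F s g `<=` meet_family U s g &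
      forall s, discrete_family setT (meet_family U s)].
Proof.
case=> oU FU dU; split.
- elim=> [|j s IH] [|i g] /=; [exact: openT|exact: open0|exact: open0|].
  exact: openI.
- elim=> [|j s IH] [|i g] //= x [Fx mx]; split; [exact: FU|exact: IH].
- elim=> [|j s IH] x.
    exists setT; first exact: filterT.
    by move=> [|i g] [|i' g'] //= _ _;
      [move=> _ [z [_ []]]|move=> [y [_ []]]|move=> [y [_ []]]].
  have [O Ox OU] := dU j x; have [P Px PU] := IH x.
  exists (O `&` P); first exact: filterI.
  move=> [|i g] [|i' g'] //= _ _; first by move=> [y [_ []]].
    by move=> _ [z [_ []]].
  move=> [y [[Oy Py] [Uy my]]] [z [[Oz Pz] [Uz mz]]].
  have -> : i = i' by apply: OU => //; [exists y|exists z].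
  by congr cons; apply: PU => //; [exists y|exists z].
Qed.

End MeetFamily.

(** * A network from a locally uniform netbase *)

Lemma locally_uniformP (T : topologicalType) (Bs : set (set (T * T))) x O :
  locally_uniform Bs -> nbhs x O -> exists2 B, Bs B & forall y z w,
    B (x, y) -> B (z, y) -> B (z, w) -> O w.
Proof.
move=> lu /lu[B BsB BO]; exists B => // y z w xy zy zw.
by apply/BO/xsectionP; exists z => //; exists y.
Qed.

Section EntourageBase.
Context (T : topologicalType) (Bs : set (set (T * T))).
Hypotheses (bBs : entourage_base Bs) (lu : locally_uniform Bs).

Lemma entourage_nbhs B x : Bs B -> nbhs x (fun y => B (x, y)).
Proof.
have [_ _ nB] := bBs => BsB; rewrite nB; exists B => //.
by move=> y /xsectionP.
Qed.

Lemma entourage_diag B x : Bs B -> B (x, x).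
Proof. by have [dB _ _] := bBs => /dB; apply. Qed.

Lemma entourage_cap B1 B2 : Bs B1 -> Bs B2 ->
  exists B, [/\ Bs B, B `<=` B1 & B `<=` B2].
Proof.
have [_ cB _] := bBs => /cB /[apply] -[B BsB BB].
by exists B; split=> // y /BB[].
Qed.

(** One step of local uniformity controls the balls that meet a ball about [x];
    two steps control all the points that share a ball with a point sharing a
    ball with [x]. *)
Lemma locally_uniform_link2 x O : nbhs x O -> exists2 B, Bs B &
  forall z z' d y, B (z, x) -> B (z, d) -> B (z', d) -> B (z', y) -> O y.
Proof.
move=> Ox; have [B0 BsB0 B0O] := locally_uniformP lu Ox.
have [B1 BsB1 B1B0] := locally_uniformP lu (entourage_nbhs x BsB0).
have [B [BsB BB0 BB1]] := entourage_cap BsB0 BsB1.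
exists B => // z z' d y zx zd z'd z'y.
apply: (B0O d z' y); [|exact: BB0|exact: BB0].
by apply: (B1B0 x z d); [exact: entourage_diag|exact: BB1|exact: BB1].
Qed.

End EntourageBase.

(** Members have to catch the point [x] only, not the whole of [C], because those
    coming from Stone's construction in an M-space may cut through [C]. *)
Definition expanded_sigma_net (T : topologicalType) (J : countType) (I : Type)
    (F : J -> I -> set T) : Prop :=
  forall x : T, exists2 C : set T, closed_countably_compact C &
    forall O, open O -> C `<=` O -> exists j i, F j i x /\ F j i `<=` O.

Section NetworkOfNetbase.
Context (T : topologicalType) (J : countType) (I : Type) (F U : J -> I -> set T).
Context (Es Bs : set (set (T * T))) (e : nat -> set (T * T)).
Hypotheses (regT : regular_space T) (T0 : @kolmogorov_space T).
Hypotheses (FU : discretely_expanded F U) (netF : expanded_sigma_net F).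
Hypotheses (nbT : star_star_netbase (@countably_compact_closure T) Es Bs)
  (lu : locally_uniform Bs) (eEs : Es `<=` range e).

Let linked (t : seq nat) (y d : T) : Prop :=
  exists2 z, fin_union e t z y & fin_union e t z d.

Let finitely_linked s t g (D : seq T) : Prop :=
  forall y, meet_family F s g y -> exists2 d, d \in D & linked t y d.

(** By discreteness, a level has at most one member at [x]; hence the meet of the
    members at [x] of finitely many levels is a single meet of the family. *)
Lemma meet_family_initial x k : exists s g, meet_family F s g x /\
  forall y, meet_family F s g y ->
    forall j i, (pickle j < k)%N -> F j i x -> F j i y.
Proof.
have [_ sFU dU] := FU.
elim: k => [|k [s [g [mx mk]]]]; first by exists [::], [::]; split.
have [[j [i [jk Fx]]]|nji] := pselect (exists j i, pickle j = k /\ F j i x).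
  exists (j :: s), (i :: g); split; first by split.
  move=> y [Fy my] j' i'; rewrite ltnS leq_eqVlt => /orP[/eqP|]; last exact: mk.
  rewrite -jk => /(pcan_inj pickleK) -> Fx'.
  have [O /nbhs_singleton Ox Ou] := dU j x.
  by rewrite (Ou i' i) //; exists x; split=> //; exact: sFU.
exists s, g; split=> // y my j i.
rewrite ltnS leq_eqVlt => /predU1P[jk Fx|]; last exact: mk.
by case: nji; exists j, i.
Qed.

(** Otherwise one picks points [u k] in the meet of the first [k] members around
    [x], pairwise not linked by the first entourages below [B]. These points
    converge to a countably compact set, so the netbase puts infinitely many of
    them in one ball of an entourage below [B], which links them. *)
Lemma finitely_linked_exists x B : Bs B -> exists s t g D,
  [/\ meet_family F s g x, forall z y, fin_union e t z y -> B (z, y) &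
      finitely_linked s t g D].
Proof.
move=> BsB; apply: contrapT => nfl.
have [_ [dB _ _] netB] := nbT.
have [C ccC CF] := netF x.
pose P k (D : seq T) y := (forall j i, (pickle j < k)%N -> F j i x -> F j i y) /\
  forall d, d \in D -> ~ linked (initial_below e B k) y d.
have [k D|u uP] := @dependent_sequence T P.
  have [s [g [mx mk]]] := meet_family_initial x k.
  apply: contrapT => nP; apply: nfl; exists s, (initial_below e B k), g, D.
  split=> // [z y|y my]; first by apply: fin_union_below; exact: dB.
  apply: contrapT => nd; apply: nP; exists y; split; first exact: mk.
  by move=> d Dd yd; apply: nd; exists d.
have unlinked i k : (i < k)%N -> ~ linked (initial_below e B k) (u k) (u i).
  by have [D [_ Dk] uD] := uP k => ik; apply: Dk; exact: uD.
have uI : injective u.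
  apply: nat_injective => i k ik uki; apply: (unlinked i k ik).
  by exists (u k); left.
have uC O : open O -> C `<=` O -> exists N, forall n, (N <= n)%N -> O (u n).
  move=> oO /(CF O oO)[j [i [Fx FO]]]; exists (pickle j).+1 => n jn.
  by have [D [Fn _] _] := uP n; apply: FO; exact: Fn.
have iu := infinite_range_inj uI.
have [E [z [EsE EB iE]]] := netB B (range u) BsB
  (near_compact_range regT T0 ccC uC)
  (near_compact_clusters regT T0 ccC uC (@subsetUr _ _ _) iu).
have [n _ en] := eEs EsE.
have iEu : infinite_set [set k | E (z, u k)].
  by apply: sub_infinite_set (infinite_indices iE) => k Ek; exact/xsectionP.
have [i ni Ei] := infinite_nat_ge n iEu.
have [k ik Ek] := infinite_nat_ge i.+1 iEu.
apply: (unlinked i k ik); exists z; apply: (@fin_union_initial _ _ _ _ n);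
  by rewrite ?en// (leq_ltn_trans ni).
Qed.

(** The meets are cut along [linked t y d], where [d] runs through a finite set
    attached to the meet. The pieces for the [n]-th point of these sets form one
    level, expanded by the meets of the expansions. A piece containing [x] is
    small because all its points are two links away from [x]. *)
Lemma expanded_network_of_netbase : has_expanded_network T.
Proof.
have [_ bBs _] := nbT; have [oU mFU dU] := meet_family_expanded FU.
have /choice[D DP] (stg : seq J * seq nat * seq I) : exists D,
    (exists D', finitely_linked stg.1.1 stg.1.2 stg.2 D') ->
    finitely_linked stg.1.1 stg.1.2 stg.2 D.
  have [[D flD]|nfl] := pselect (exists D,
    finitely_linked stg.1.1 stg.1.2 stg.2 D); first by exists D.
  by exists [::].
pose N (stn : seq J * seq nat * nat) g : set T := meet_family F stn.1.1 g `&`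
  [set y | (stn.2 < size (D (stn.1, g)))%N /\
           linked stn.1.2 y (nth y (D (stn.1, g)) stn.2)].
exists (seq J * seq nat * nat)%type, (seq I), N, (fun stn => meet_family U stn.1.1).
split; first split.
- by move=> stn g; exact: oU.
- by move=> stn g y [/mFU].
- by move=> stn; exact: dU.
move=> x O Ox; have [B BsB BO] := locally_uniform_link2 bBs lu Ox.
have [s [t [g [D' [mx tB flD']]]]] := finitely_linked_exists x BsB.
have flD : finitely_linked s t g (D (s, t, g)) by apply: (DP (s, t, g)); exists D'.
have [d Dd xd] := flD x mx.
have Dn := Dd; rewrite -index_mem in Dn.
exists (s, t, index d (D (s, t, g))), g; split.
  by split=> //; split=> //=; rewrite nth_index.
move=> y [my [_ /=]]; rewrite nth_index// => -[z' z'y z'd].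
have [z zx zd] := xd.
by apply: (BO z z' d y); exact: tB.
Qed.

End NetworkOfNetbase.

(** * Neighbourhoods from a netbase *)

Lemma locally_uniform_regular (T : topologicalType) (Bs : set (set (T * T))) :
  entourage_base Bs -> locally_uniform Bs -> regular_space T.
Proof.
move=> bBs lu x O Ox; have [B BsB BO] := locally_uniformP lu Ox.
exists (fun y => B (x, y)); first exact (entourage_nbhs bBs x BsB).
move=> y cly; have [p [xp yp]] := cly _ (entourage_nbhs bBs y BsB).
by apply: BO xp yp _; exact (entourage_diag bBs _ BsB).
Qed.

(** A sequence that converges to [x] without taking this value has an infinite
    range, because its range avoids [x] and finite sets are closed. *)
Section EscapingSequence.
Context (T : topologicalType) (x : T) (u : nat -> T).
Hypotheses (regT : regular_space T) (T0 : @kolmogorov_space T).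
Hypotheses (ux : forall O, nbhs x O -> exists N, forall n, (N <= n)%N -> O (u n))
  (nux : forall n, u n <> x).

Lemma escaping_clusters : clusters_at (range u) x.
Proof.
move=> O Ox fO; have nx : ~ (O `&` range u) x by move=> [_ [n _ /nux]].
have [N uN] := ux (filterI Ox (nbhs_avoid_finite regT T0 fO nx)).
by have [ON] := uN N (leqnn N); apply; split=> //; exists N.
Qed.

Lemma escaping_infinite : infinite_set (range u).
Proof.
rewrite -[range u]setTI; apply: escaping_clusters; exact: filterT.
Qed.

Lemma escaping_convergent : convergent_sequences (range u).
Proof.
split; first exact: escaping_infinite.
exists u, x; split=> // O /ux[N uN]; exists N => // n /uN.
Qed.

Lemma escaping_countably_compact : countably_compact_closure (range u).
Proof.
apply: (@near_compact_range _ regT T0 [set x]).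
  split; first exact: (accessible_closed_set1 (regular_T1 regT T0)).
  by move=> A /sub_finite_set fA; case; apply: fA; exact: finite_set1.
move=> O oO xO; apply: ux; apply: open_nbhs_nbhs; split=> //.
exact: xO.
Qed.

End EscapingSequence.

Section NeighbourhoodsFromNetbase.
Context (T : topologicalType) (Es Bs : set (set (T * T))) (e : nat -> set (T * T)).
Hypotheses (regT : regular_space T) (T0 : @kolmogorov_space T).
Hypotheses (baseT : seq_bases T) (eEs : Es `<=` range e).

(** If no [S t x] were a neighbourhood, a sequence converging to [x] would escape
    all of them. *)
Lemma escape_initial (S : seq nat -> T -> T -> Prop) B x :
  (forall t y, S t y y) -> diagonal `<=` B ->
  (forall u : nat -> T,
     (forall O, nbhs x O -> exists N, forall n, (N <= n)%N -> O (u n)) ->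
     (forall n, u n <> x) ->
     exists n, S (initial_below e B n) x (u n)) ->
  exists t, (forall y z, fin_union e t y z -> B (y, z)) /\ nbhs x (S t x).
Proof.
move=> Sxx dB Su; apply: contrapT => nt; have [V Vx VO] := baseT x.
have /choice[u uP] n : exists y, V n y /\ ~ S (initial_below e B n) x y.
  apply: contrapT => nex; apply: nt; exists (initial_below e B n); split.
    by move=> y z; exact: fin_union_below.
  apply: filterS (Vx n) => y Vy; apply: contrapT => nS.
  by apply: nex; exists y.
have [O /VO[N VN]|n unx|n Sn] := Su u.
- by exists N => n Nn; apply: (VN n Nn); exact: (uP n).1.
- by have [_] := uP n; rewrite unx; apply.
- exact: (uP n).2.
Qed.

Lemma cs_star_nbhs B x :
  star_netbase (@convergent_sequences T) Es Bs -> Bs B ->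
  exists t, (forall y z, fin_union e t y z -> B (y, z)) /\
            nbhs x (fin_union e t x).
Proof.
move=> [_ [dB _ _] netB] BsB; apply: escape_initial; [by left|exact: dB|].
move=> u ux nux; have [_ [[E [EsE EB] <-] _ _ iE]] := netB B x BsB setT (range u) filterT
  (escaping_convergent regT T0 ux nux) (escaping_clusters regT T0 ux nux).
have [n _ en] := eEs EsE.
have [k nk Ek] := infinite_nat_ge n.+1 (infinite_indices iE).
exists k; apply: (@fin_union_initial _ _ _ _ n); rewrite ?en//.
exact/xsectionP.
Qed.

(** The ball that the netbase gives need not be about [x], but [x] is in its
    closure. *)
Definition closure_linked (t : seq nat) (x y : T) : Prop :=
  exists2 z, closure (fin_union e t z) x & fin_union e t z y.

Lemma csbar_star_star_nbhs B x :
  star_star_netbase (@countably_compact_closure T) Es Bs -> Bs B ->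
  exists t, (forall y z, fin_union e t y z -> B (y, z)) /\
            nbhs x (closure_linked t x).
Proof.
move=> [_ [dB _ _] netB] BsB; apply: escape_initial; [|exact: dB|].
  by move=> t y; exists y; [apply: subset_closure|]; left.
move=> u ux nux; have [||E [z [EsE EB iE]]] := netB B (range u) BsB.
- exact: escaping_countably_compact regT T0 ux.
- by exists x; exact: escaping_clusters regT T0 ux nux.
have [n _ en] := eEs EsE; have iEu := infinite_indices iE.
have [k nk Ek] := infinite_nat_ge n.+1 iEu.
have sub y : E (z, y) -> fin_union e (initial_below e B k) z y.
  by move=> zy; apply: (@fin_union_initial _ _ _ _ n); rewrite ?en.
exists k, z; last by apply: sub; exact/xsectionP.
move=> O /ux[N uN]; have [m Nm Em] := infinite_nat_ge N iEu.
by exists (u m); split; [apply: sub; exact/xsectionP|exact: uN].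
Qed.

(** A countable set that clusters at [x] contains a sequence converging to [x],
    and a [star_netbase] catches it by a ball about [x]. *)
Lemma csbar_of_cs_netbase : star_netbase (@convergent_sequences T) Es Bs ->
  star_star_netbase (@countably_compact_closure T) Es Bs.
Proof.
move=> [dE bBs netB]; split=> // B C BsB [_ _] [x xC].
have [V Vx VO] := baseT x.
have /choice[u uP] n : exists y, [/\ V n y, C y & y <> x].
  apply: contrapT => nex; apply: (xC _ (Vx n)).
  apply: sub_finite_set (finite_set1 x) => y [Vy Cy] /=.
  by apply: contrapT => yx; apply: nex; exists y.
have ux O : nbhs x O -> exists N, forall n, (N <= n)%N -> O (u n).
  move=> /VO[N VN]; exists N => n Nn; apply: (VN n Nn).
  by have [] := uP n.
have nux n : u n <> x by have [] := uP n.
have [_ [[E [EsE EB] <-] _ _ iE]] := netB B x BsB setT (range u) filterT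
  (escaping_convergent regT T0 ux nux) (escaping_clusters regT T0 ux nux).
exists E, x; split=> //; apply: sub_infinite_set iE => y [Ey [n _ uy]].
by split=> //; rewrite -uy; have [] := uP n.
Qed.

Lemma cs_star_quasi_development :
  star_netbase (@convergent_sequences T) Es Bs -> locally_quasi_uniform Bs ->
  quasi_development (fin_union e).
Proof.
move=> net lqu x O /lqu[B BsB BO]; have [t [tB xt]] := cs_star_nbhs x net BsB.
exists t; split=> // y z xy yz; apply/BO/xsectionP.
by exists y; exact: tB.
Qed.

(** A pair related by [closure_linked t] is joined by a chain of three steps
    [B], [B^-1], [B]. Three successive applications of local uniformity provide a
    [B] for which two consecutive chains starting at [x] end inside [O]. *)
Lemma csbar_star_star_quasi_development :
  star_star_netbase (@countably_compact_closure T) Es Bs -> locally_uniform Bs ->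
  quasi_development closure_linked.
Proof.
move=> net lu x O Ox; have [_ bBs _] := net.
have [B0 BsB0 B0O] := locally_uniformP lu Ox.
have [B1' BsB1' B1'B0] := locally_uniformP lu (entourage_nbhs bBs x BsB0).
have [B1 [BsB1 B1B0 B11]] := entourage_cap bBs BsB0 BsB1'.
have [B' BsB' B'B1] := locally_uniformP lu (entourage_nbhs bBs x BsB1).
have [B [BsB BB1 BB']] := entourage_cap bBs BsB1 BsB'.
have [t [tB xt]] := csbar_star_star_nbhs x net BsB; exists t; split=> // y z.
have step a b : closure_linked t a b -> exists p q,
    [/\ B (a, p), B (q, p) & B (q, b)].
  move=> [q cla qb]; have [p [qp ap]] := cla _ (entourage_nbhs bBs a BsB).
  by exists p, q; split=> //; exact: tB.
move=> /step[p [q [xp qp qy]]] /step[r [s [yr sr sz]]].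
have xy : B1 (x, y) by apply: (B'B1 p q y); exact: BB'.
have xr : B0 (x, r).
  apply: (B1'B0 y y r); [exact: B11|exact (entourage_diag bBs _ BsB1')|].
  exact/B11/BB1.
by apply: (B0O r s z) => //; exact/B1B0/BB1.
Qed.

End NeighbourhoodsFromNetbase.

(** [W t] is covered by the interiors of the balls of [fin_union e t], and the
    complement of [W t] by any of the open sets [G t n], whose closures shrink
    to it. The relation [S (t, n)] of sharing a member of the resulting cover
    satisfies Moore's criterion at a point [x] whose ball is a neighbourhood:
    as [x] is in [W t], some closure of [G t n] avoids it, and near [x] only the
    small balls matter. *)
Lemma discrete_base_of_Gdelta_bar (T : topologicalType)
    (Es Bs : set (set (T * T))) (e : nat -> set (T * T)) :
  regular_space T -> @kolmogorov_space T -> seq_bases T ->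
  closed_Gdelta_bar T -> Es `<=` range e ->
  star_netbase (@convergent_sequences T) Es Bs -> locally_uniform Bs ->
  exists (J : countType) (I : Type) (G : J -> I -> set T), discrete_base G.
Proof.
move=> regT T0 baseT GT eEs net lu.
pose P t y := interior (fin_union e t y).
pose W t := \bigcup_y P t y.
have /choice[G GP] t : exists G : nat -> set T,
    [/\ forall n, open (G n), ~` W t = \bigcap_n G n &
        ~` W t = \bigcap_n closure (G n)].
  by apply: GT; apply: open_closedC; apply: bigcup_open => y _; exact: open_interior.
pose S (tn : seq nat * nat) p q :=
  (exists y, P tn.1 y p /\ P tn.1 y q) \/ (G tn.1 tn.2 p /\ G tn.1 tn.2 q).
apply: (@moore_discrete_base T _ S) => [[t n] p|[t n] p q|x O Ox].
- have [oG WG _] := GP t; have [[y _ yp]|nWp] := pselect (W t p).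
    exists (P t y); last by move=> q r yq yr; left; exists y.
    by apply: open_nbhs_nbhs; split=> //; exact: open_interior.
  exists (G t n); last by move=> q r Gq Gr; right.
  apply: open_nbhs_nbhs; split; first exact: oG.
  by have : (~` W t) p by []; rewrite WG; apply.
- by move=> [[y [yp yq]]|[Gp Gq]]; [left; exists y|right].
have [B BsB BO] := locally_uniformP lu Ox.
have [t [tB xt]] := cs_star_nbhs regT T0 baseT eEs x net BsB.
have [oG _ clG] := GP t.
have [n nGx] : exists n, ~ closure (G t n) x.
  apply: contrapT => nn; suff : (~` W t) x by apply; exists x.
  by rewrite clG => n _; apply: contrapT => nGx; apply: nn; exists n.
exists (t, n); apply: filterS2 xt (closed_nbhs (@closed_closure _ _) nGx).
move=> v xv nGv q [[y [/interior_subset yv /interior_subset yq]]|[Gv _]].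
  by apply: (BO v y q); exact: tB.
by case: nGv; exact: subset_closure.
Qed.

(** * Strong sigma-spaces, Sigma-spaces and M-spaces *)

Lemma expand_strongly_discrete (T : topologicalType) (Ns : nat -> set (set T)) :
  (forall n, strongly_discrete (Ns n)) -> exists F U : nat -> set T -> set T,
    discretely_expanded F U /\ forall n A, Ns n A -> F n A = A.
Proof.
move=> /choice[U UP].
exists (fun n A => [set x | Ns n A /\ A x]), (fun n A => [set x | Ns n A /\ U n A x]).
split; first split.
- move=> n A; have [NA|nNA] := pselect (Ns n A).
    rewrite (_ : [set _ | _] = U n A); first by have [/(_ A NA)[]] := UP n.
    by apply/seteqP; split=> x //= [].
  by rewrite (_ : [set _ | _] = set0); [exact: open0|apply/seteqP; split=> x //= []].
- by move=> n A x [NA Ax]; split=> //; have [/(_ A NA)[_ AU] _] := UP n; exact: AU.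
- move=> n x; have [_ /(_ x)[O Ox OU]] := UP n; exists O => // A B _ _.
  by move=> [y [Oy [NA UA]]] [z [Oz [NB UB]]]; apply: OU => //; [exists y|exists z].
by move=> n A NA; apply/seteqP; split=> x //= [].
Qed.

Lemma strong_sigma_expanded_network (T : topologicalType) :
  strong_sigma_space T -> has_expanded_network T.
Proof.
move=> [_ _ [N [Ns NE sNs] netN]].
have [F [U [FU FE]]] := expand_strongly_discrete sNs.
exists nat, (set T), F, U; split=> // x O.
move=> /[dup] Ox; rewrite nbhsE => -[P [oP Px] PO].
have [A] := netN P x oP Px; rewrite NE => -[n _ NA] [Ax AP].
by exists n, A; rewrite FE//; split=> //; exact: subset_trans PO.
Qed.

(** The closures of the members form a discrete family of closed sets, with
    distinct closures for distinct members, so their expansions can be used. *)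
Lemma collectionwise_normal_strongly_discrete (T : topologicalType)
    (N : set (set T)) :
  collectionwise_normal T -> discrete_family N id -> strongly_discrete N.
Proof.
move=> cwn dN.
have cl_inj A B : N A -> N B -> closure A = closure B -> A = B.
  move=> NA NB AB; have [[x Ax]|A0] := pselect (A !=set0); last first.
    have -> : A = set0 by apply/seteqP; split=> // x Ax; apply: A0; exists x.
    apply/esym/seteqP; split=> // x /subset_closure; rewrite -AB => clA.
    by have [y [Ay _]] := clA setT filterT; apply: A0; exists y.
  have [O Ox OE] := dN x; apply: OE => //.
    by exists x; split=> //; exact: nbhs_singleton.
  have /(_ O Ox)[y [By Oy]] : closure B x by rewrite -AB; exact: subset_closure.
  by exists y.
have [|x|U [UP dU]] := cwn (closure @` N).
- by move=> _ [A _ <-]; exact: closed_closure.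
- have [O Ox OE] := dN x; exists (interior O).
    by apply: open_nbhs_nbhs; split; [exact: open_interior|exact: Ox].
  have meets A : interior O `&` closure A !=set0 -> O `&` A !=set0.
    move=> [y [Oy clA]]; have [z [Az Oz]] := clA _ Oy.
    by exists z.
  by move=> _ _ [A NA <-] [B NB <-] /meets OA /meets OB; rewrite (OE A B).
exists (fun A => U (closure A)); split.
  move=> A NA; have [oU AU] := UP (closure A) (imageP _ NA).
  by split=> //; exact: subset_trans (@subset_closure _ A) AU.
move=> x; have [O Ox OE] := dU x; exists O => // A B NA NB OA OB.
by apply: cl_inj => //; apply: OE => //; exact: imageP.
Qed.

Lemma Sigma_space_expanded_net (T : topologicalType) :
  collectionwise_normal T -> Sigma_space T ->
  exists F U : nat -> set T -> set T,
    discretely_expanded F U /\ expanded_sigma_net F.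
Proof.
move=> cwn [_ _ [Cs [N [covC ccC [Ns NE dNs] NC]]]].
have [F [U [FU FE]]] := expand_strongly_discrete
  (fun n => collectionwise_normal_strongly_discrete cwn (dNs n)).
exists F, U; split=> // x.
have [C CsC Cx] : cover Cs id x by rewrite covC.
exists C; first exact: ccC.
move=> O oO CO; have [A] := NC C O CsC oO CO.
rewrite NE => -[n _ NA] [CA AO]; exists n, A; rewrite FE//.
by split=> //; exact: CA.
Qed.

Section MSpace.
Context (T : topologicalType) (Us : nat -> set (set T)).
Hypotheses (coverUs : forall n, open_cover (Us n))
  (starUs : forall n, star_refines (Us n.+1) (Us n))
  (clusUs : forall (x : T) (u : nat -> T),
     (forall n, (\bigcup_(U in [set U | Us n U /\ U x]) U) (u n)) ->
     exists y, seq_clusters_at u y).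

Let S n (x y : T) : Prop := exists2 U, Us n U & U x /\ U y.

Let Sdiag n : near_diagonal (S n).
Proof.
move=> p; have [oUs cUs] := coverUs n.
have [U UsU Up] : cover (Us n) id p by rewrite cUs.
exists U; last by move=> q r Uq Ur; exists U.
by apply: open_nbhs_nbhs; split=> //; exact: oUs.
Qed.

Let Ssym n x y : S n x y -> S n y x.
Proof. by move=> [U UsU [Ux Uy]]; exists U. Qed.

Let Strans n y x z : S n.+1 x y -> S n.+1 y z -> S n x z.
Proof.
move=> [V UsV [Vx Vy]] [W UsW [Wy Wz]]; have [U UsU VU] := starUs UsV.
exists U => //; split; apply: VU; last by exists W => //; split=> //; exists y.
by exists V => //; split=> //; exists y.
Qed.

Let Smono n m x y : (n <= m)%N -> S m x y -> S n x y.
Proof.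
move=> /subnK <-; elim: (m - n)%N => // k IH Sxy; apply: IH.
exact: Strans Sxy (near_diagonal_refl y (Sdiag _)).
Qed.

Let Sclus x (u : nat -> T) : (forall n, S n x (u n)) ->
  exists2 y, seq_clusters_at u y & forall n, S n x y.
Proof.
move=> xu; have [|y uy] := clusUs (x := x) (u := u).
  by move=> n; have [U UsU [Ux Uu]] := xu n; exists U.
exists y => // n.
have [m nm ym] := infinite_nat_ge n.+1 (uy _ (near_diagonal_nbhs y (Sdiag n.+1))).
by apply: (Strans (y := u m)); [exact: Smono nm (xu m)|exact: Ssym].
Qed.

(** The set of points that no cover separates from [x] is the countably compact
    set attached to [x]. *)
Let core_countably_compact x : closed_countably_compact [set y | forall n, S n x y].
Proof.
split=> [y cly n|A AC iA].
  have [p [xp yp]] := cly _ (near_diagonal_nbhs y (Sdiag n.+1)).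
  by apply: Strans (xp n.+1) _; exact: Ssym.
have [u uI uA] := infinite_injection iA.
have [|y uy _] := @Sclus x u; first by move=> n; exact: AC.
exists y => O Oy fO; apply: (uy O Oy).
apply: sub_finite_set (finite_preimage (f := u) _ fO); first by move=> n Ou; split.
by move=> n m _ _ /uI.
Qed.

(** The members of the covers need not be open for the uniformity that the
    covers generate, as Stone's construction requires. They are replaced by
    the uniform interiors [O n p] of the stars of points. *)
Lemma M_space_expanded_net : exists (J : countType) (I : Type)
  (F U : J -> I -> set T), discretely_expanded F U /\ expanded_sigma_net F.
Proof.
pose O n (p : T) : set T := [set y | exists k, forall r, S k y r -> S n p r].
have /choice[G GP] n : exists G : nat * nat -> T -> set T,
    [/\ forall j i, open (G j i), forall j, discrete_family setT (G j),
      forall j i, G j i `<=` O n i & forall x, exists j i, G j i x].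
  have [|G [oG dG GO cG]] := @stone_refinement T nat T S (O n) Sdiag Ssym.
    (* four steps of level [k.+2] are one step of level [k] *)
    move=> p x [k xk]; exists k.+2, k.+2.
    apply: filterS (near_diagonal_nbhs x (Sdiag k.+2)) => v xv q vq r qr.
    exists k.+2 => r' rr'; apply: xk.
    exact: Strans (Strans xv vq) (Strans qr rr').
  by exists G; split=> // x; apply: (cG x); exists n.
exists (nat * (nat * nat))%type, T, (fun j => G j.1 j.2), (fun j => G j.1 j.2).
split; first split.
- by move=> [n j] i; have [] := GP n.
- by move=> j i x.
- by move=> [n j]; have [] := GP n.
move=> x; exists [set y | forall n, S n x y]; first exact: core_countably_compact.
move=> P oP CP.
have [n nP] : exists n, forall y, S n x y -> P y.
  apply: contrapT => nn.
  have /choice[u uP] n : exists y, S n x y /\ ~ P y.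
    apply: contrapT => nex; apply: nn; exists n => y xy.
    by apply: contrapT => nPy; apply: nex; exists y.
  have [|y uy Cy] := @Sclus x u; first by move=> n; exact: (uP n).1.
  have [m _ Pm] := infinite_nat_ge 0 (uy P (open_nbhs_nbhs (conj oP (CP y Cy)))).
  exact: (uP m).2.
have [_ _ GO cG] := GP n.+1; have [j [i Gx]] := cG x.
have GS z : G n.+1 j i z -> S n.+1 i z.
  by move=> /GO[k]; apply; exact: near_diagonal_refl z (Sdiag k).
exists (n.+1, j), i; split=> // y /GS iy; apply: nP.
by apply: Strans iy; apply: Ssym; exact: GS.
Qed.

Lemma M_space_q_space : q_space T.
Proof.
move=> x; exists (fun n => S n x).
  by move=> n; exact (near_diagonal_nbhs x (Sdiag n)).
by move=> u /Sclus[y uy _]; exists y.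
Qed.

End MSpace.

(** * Metrizable spaces satisfy all the conditions *)

Lemma locally_uniform_quasi (T : topologicalType) (Bs : set (set (T * T))) :
  entourage_base Bs -> locally_uniform Bs -> locally_quasi_uniform Bs.
Proof.
move=> bBs lu x O Ox; have [B BsB BO] := locally_uniformP lu Ox.
exists B => // y /xsectionP[z xz zy]; apply: (BO z z y) => //.
exact (entourage_diag bBs z BsB).
Qed.

Section Metric.
Local Open Scope ring_scope.
Context (R : realType) (T : topologicalType) (d : T -> T -> R).
Hypothesis hd : compatible_metric d.

Let dxx x : d x x = 0. Proof. by case: hd. Qed.
Let deq x y : d x y = 0 -> x = y. Proof. by case: hd => _ + _ _ _; apply. Qed.
Let dC x y : d x y = d y x. Proof. by case: hd. Qed.
Let dD y x z : d x z <= d x y + d y z. Proof. by case: hd. Qed.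

Let dball x (e : R) : set T := [set y | d x y < e].

Let dballP x e : 0 < e -> nbhs x (dball x e).
Proof. by have [_ _ _ _ ->] := hd => e0; exists e. Qed.

Let dballO x O : nbhs x O -> exists2 e, 0 < e & forall y, d x y < e -> O y.
Proof. by have [_ _ _ _ ->] := hd => -[e e0 eO]; exists e. Qed.

Let dballn x O : nbhs x O -> exists n, forall y, d x y < n.+1%:R^-1 -> O y.
Proof.
move=> /dballO[e e0 eO]; have [n ne] := invS_lt e0; exists n => y xy.
exact/eO/(lt_trans xy).
Qed.

Let dball_half x (e : R) : 0 < e -> nbhs x (dball x (e / 2)).
Proof. by move=> e0; apply: dballP; rewrite divr_gt0. Qed.

Let d_lt3 x y z t (e : R) : d x y < e / 3%:R -> d z y < e / 3%:R ->
  d z t < e / 3%:R -> d x t < e.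
Proof.
move=> xy zy zt; have := dD y x t; have := dD z y t; rewrite (dC y z); lra.
Qed.

Let d_lt2 x y z (e : R) : d x y < e / 2 -> d y z < e / 2 -> d x z < e.
Proof. by move=> xy yz; have := dD y x z; lra. Qed.

Lemma metric_first_countable : first_countable T.
Proof.
move=> x; exists (range (fun n => dball x n.+1%:R^-1)).
  exact: card_image_le.
apply/seteqP; split=> [O /dballn[n nO]|O [_ [n _ <-] nO]].
  by exists (dball x n.+1%:R^-1) => //; exists n.
by apply: filterS nO (dballP x _); exact: invS_gt0.
Qed.

Lemma metric_regular : regular_space T.
Proof.
move=> x O /dballO[e e0 eO]; exists (dball x (e / 2)); first exact: dball_half.
move=> y cly; have [z [xz yz]] := cly _ (dball_half y e0).
by apply: eO; apply: d_lt2 xz _; rewrite dC.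
Qed.

Lemma metric_closed_Gdelta_bar : closed_Gdelta_bar T.
Proof.
move=> F cF.
pose W n : set T := \bigcup_(x in F) interior (dball x n.+1%:R^-1).
have FW n : F `<=` W n.
  by move=> x Fx; exists x => //; apply: dballP; exact: invS_gt0.
have clWF : \bigcap_n closure (W n) `<=` F.
  move=> y clW; apply: contrapT => nFy.
  have [e e0 eF] := dballO (closed_nbhs cF nFy).
  have e20 : 0 < e / 2 by rewrite divr_gt0.
  have [n ne] := invS_lt e20.
  have [z [[x Fx /interior_subset xz] yz]] := clW n I _ (dball_half y e0).
  by apply: (eF x _ Fx); apply: d_lt2 yz _; rewrite dC; exact: lt_trans xz ne.
exists W; split.
- by move=> n; apply: bigcup_open => x _; exact: open_interior.
- apply/seteqP; split=> [x Fx n _|x Wx]; first exact: FW.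
  by apply: clWF => n _; apply: subset_closure; exact: Wx.
- apply/seteqP; split=> // x Fx n _.
  by apply: subset_closure; exact: FW.
Qed.

Lemma metric_discrete_base :
  exists (J : countType) (I : Type) (G : J -> I -> set T), discrete_base G.
Proof.
apply: (@moore_discrete_base T nat (fun n x y => d x y < n.+1%:R^-1)).
- move=> n p; exists (dball p (n.+1%:R^-1 / 2)).
    by apply: dball_half; exact: invS_gt0.
  by move=> q r pq pr; apply: d_lt2 pr; rewrite dC.
- by move=> n x y; rewrite dC.
move=> x O /dballO[e e0 eO]; have e20 : 0 < e / 2 by rewrite divr_gt0.
have [n ne] := invS_lt e20; exists n; apply: filterS (dball_half x e0) => v xv q vq.
by apply: eO; apply: d_lt2 xv _; exact: lt_trans vq ne.
Qed.

Lemma metric_sets_base : exists Ns : nat -> set (set T),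
  [/\ forall n A, Ns n A -> open A, forall n, discrete_family (Ns n) id &
      forall x O, nbhs x O -> exists n A, [/\ Ns n A, A x & A `<=` O]].
Proof.
have [J [I [G /discrete_base_nat[H [oH dH bH]]]]] := metric_discrete_base.
exists (fun n => range (H n)); split.
- by move=> n _ [i _ <-]; exact: oH.
- move=> n x; have [O Ox OH] := dH n x; exists O => // _ _ [i _ <-] [k _ <-].
  by move=> Oi Ok; rewrite (OH i k).
- move=> x O /bH[n [i [Hx HO]]]; exists n, (H n i); split=> //.
Qed.

Lemma metric_strong_sigma_space : @kolmogorov_space T -> strong_sigma_space T.
Proof.
move=> T0; have [Ns [oN dN bN]] := metric_sets_base.
split=> //; first exact: metric_regular.
exists (\bigcup_n Ns n).
  by exists Ns => // n; exists id; split=> // F /oN; split.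
move=> U x oU Ux; have [n [A [NA Ax AU]]] := bN x U (open_nbhs_nbhs (conj oU Ux)).
by exists A => //; exists n.
Qed.

Lemma metric_Sigma_space : @kolmogorov_space T -> Sigma_space T.
Proof.
move=> T0; have [Ns [oN dN bN]] := metric_sets_base.
split=> //; first exact: metric_regular.
exists (range (fun x => [set x])), (\bigcup_n Ns n); split.
- by apply/seteqP; split=> // x _; exists [set x] => //; exists x.
- move=> _ [x _ <-]; split.
    exact: (accessible_closed_set1 (regular_T1 metric_regular T0)).
  by move=> A /sub_finite_set fA; case; apply: fA; exact: finite_set1.
- by exists Ns.
- move=> _ U [x _ <-] oU xU.
  have [n [A [NA Ax AU]]] := bN x U (open_nbhs_nbhs (conj oU (xU x erefl))).
  exists A; first by exists n.
  by split=> // y ->.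
Qed.

(** A point [x] of a member [F] gets the radius [r x / 4], where the ball of radius
    [r x] meets no other member. If the balls about [x] and [y] both
    come within [delta] of a point [p], then [r x] and [r y] are at most
    [4 * delta], so that [x] and [y] are close to [p]. *)
Lemma metric_collectionwise_normal : collectionwise_normal T.
Proof.
move=> N clN dN.
have rex x : exists r : R, 0 < r /\
    (forall F G, N F -> N G -> F x -> dball x r `&` G !=set0 -> F = G).
  have [O /dballO[e e0 eO] OF] := dN x; exists e; split=> // F G NF NG Fx.
  move=> [y [xy Gy]]; apply: OF => //.
    by exists x; split=> //; apply: eO; rewrite dxx.
  by exists y; split=> //; exact: eO.
have /choice[r rP] := rex.
exists (fun F => \bigcup_(x in F) interior (dball x (r x / 4%:R))); split.
  move=> F NF; split; first by apply: bigcup_open => x _; exact: open_interior.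
  move=> x Fx; exists x => //; apply: dballP; rewrite divr_gt0//.
  exact: (rP x).1.
move=> p; have [O /dballO[e e0 eO] OF] := dN p.
exists (dball p (e / 4%:R)); first by apply: dballP; rewrite divr_gt0.
move=> F G NF NG [q [pq [x Fx /interior_subset xq]]].
move=> [q' [pq' [y Gy /interior_subset yq']]].
apply: contrapT => FG.
have far x' y' F' G' : N F' -> N G' -> F' x' -> G' y' -> F' <> G' -> r x' <= d x' y'.
  move=> NF' NG' Fx' Gy' FG'; rewrite leNgt; apply/negP => xy'; apply: FG'.
  by apply: (rP x').2 NF' NG' Fx' _; exists y'.
have rx := far x y F G NF NG Fx Gy FG.
have ry := far y x G F NG NF Gy Fx (nesym FG).
rewrite dC in ry; rewrite /dball/= in pq pq' xq yq'.
have xy : d x y <= d p x + d p y by rewrite (dC p x); exact: dD.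
have px : d p x <= d p q + d x q by rewrite (dC x q); exact: dD.
have py : d p y <= d p q' + d y q' by rewrite (dC y q'); exact: dD.
apply: FG; apply: OF => //; [exists x|exists y]; split=> //; apply: eO; lra.
Qed.

(** The covers by open sets of diameter about [3^-n] star-refine each other, as
    passing to the star multiplies the bound on the diameter by three. *)
Lemma metric_M_space : @kolmogorov_space T -> M_space T.
Proof.
move=> T0; split=> //; first exact: metric_regular.
pose w n : R := 3%:R ^- n.
have w0 n : 0 < w n by rewrite invr_gt0 exprn_gt0.
have wS n : w n.+1 = w n / 3%:R by rewrite /w exprS invfM mulrC.
exists (fun n => [set U | open U /\ forall x y, U x -> U y -> d x y < w n]); split.
- move=> n; split=> [U []//|]; apply/seteqP; split=> // x _.
  exists (interior (dball x (w n / 2))); last exact: dball_half.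
  split; first exact: open_interior.
  move=> y z /interior_subset xy /interior_subset xz.
  by apply: d_lt2 xz; rewrite dC.
- move=> n V [oV V3]; eexists; last exact: subset_refl.
  split; first by apply: bigcup_open => W [[]].
  move=> x y [W [[_ W3] [p [Wp Vp]]] Wx] [W' [[_ W3'] [q [W'q Vq]]] W'y].
  apply: (@d_lt3 x p q y); rewrite -wS; [exact: W3|exact: V3|exact: W3'].
move=> x u xu; exists x => O Ox.
have [e e0 eO] := dballO Ox.
have [n ne] : exists n, w n < e.
  have [n ne] := invS_lt e0; exists n; apply: le_lt_trans ne.
  rewrite lef_pV2 ?posrE ?exprn_gt0 ?ltr0n// -natrX ler_nat.
  exact: ltn_expl.
apply: (@sub_infinite_set _ [set m | (n <= m)%N]); last first.
  move=> fin; apply: infinite_nat; rewrite -(setUv `I_n) finite_setU; split.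
    exact: finite_II.
  by apply: sub_finite_set fin => m /= /negP; rewrite -leqNgt.
move=> m /= nm; apply: eO.
have [U [[_ Uw] Ux] Um] := xu m; apply: lt_trans (Uw x _ Ux Um) _.
apply: le_lt_trans ne; rewrite lef_pV2 ?posrE ?exprn_gt0//.
by rewrite ler_weXn2l// ler1n.
Qed.

(** One countable uniform base serves both as [Es] and as [Bs]. *)
Let entourages : set (set (T * T)) :=
  range (fun n => [set xy : T * T | d xy.1 xy.2 < n.+1%:R^-1]).

Let entourages_base : entourage_base entourages.
Proof.
split.
- move=> _ [n _ <-] [x y] xy; have /= -> : x = y := xy.
  by rewrite dxx invS_gt0.
- move=> _ _ [n _ <-] [m _ <-].
  exists [set xy : T * T | d xy.1 xy.2 < (maxn n m).+1%:R^-1]; first by exists (maxn n m).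
  by move=> [x y] /= xy; split; apply: lt_le_trans xy _;
    rewrite lef_pV2 ?posrE ?ltr0n// ler_nat ltnS ?leq_maxl ?leq_maxr.
- move=> x; apply/seteqP; split=> [O /dballn[n nO]|O [_ [n _ <-] nO]].
    exists [set xy : T * T | d xy.1 xy.2 < n.+1%:R^-1]; first by exists n.
    by move=> y /xsectionP/nO.
  apply: filterS (dballP x (invS_gt0 R n)) => y xy; apply: nO.
  exact/xsectionP.
Qed.

Let entourages_locally_uniform : locally_uniform entourages.
Proof.
move=> x O /dballO[e e0 eO]; have e30 : 0 < e / 3%:R by rewrite divr_gt0.
have [n ne] := invS_lt e30.
exists [set xy : T * T | d xy.1 xy.2 < n.+1%:R^-1]; first by exists n.
move=> y /xsectionP[z [t xt zt] zy]; apply: eO.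
apply: (@d_lt3 x t z y); [exact: lt_trans xt ne|exact: lt_trans zt ne|].
exact: lt_trans zy ne.
Qed.

Let entourages_countable : countable entourages.
Proof. exact: card_image_le. Qed.

Lemma metric_lu_cs_star_netbase : has_countable_lu_cs_star_netbase T.
Proof.
exists entourages, entourages; split=> //; have [dB cB nB] := entourages_base.
split=> // B x BsB O C Ox _ xC.
have [n nO] := dballn Ox; have BsE : entourages [set xy | d xy.1 xy.2 < n.+1%:R^-1].
  by exists n.
have [E BsE' EB] := cB _ _ BsB BsE.
have xE : nbhs x (xsection E x) by rewrite nB; exists E.
exists (xsection E x); split.
- by exists E => //; split=> // p /EB[].
- exact: nbhs_singleton.
- by move=> y /xsectionP/EB[_]; exact: nO.
- exact: xC.
Qed.

Lemma metric_lqu_cs_star_netbase : has_countable_lqu_cs_star_netbase T.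
Proof.
have [Es [Bs [nb cEs lu]]] := metric_lu_cs_star_netbase; exists Es, Bs.
split=> //; have [_ bBs _] := nb; exact: locally_uniform_quasi.
Qed.

Lemma metric_lu_csbar_star_star_netbase :
  has_countable_lu_csbar_star_star_netbase T.
Proof.
exists entourages, entourages; split=> //; have [dB cB nB] := entourages_base.
split=> // B C BsB _ [x xC]; exists B, x; split=> //; apply: xC.
by rewrite nB; exists B.
Qed.

End Metric.

(** * The equivalence *)

Section Main.
Context (R : realType) (T : topologicalType).
Hypothesis T0 : @kolmogorov_space T.

Lemma metrizable_of_base : regular_space T ->
  (exists (J : countType) (I : Type) (G : J -> I -> set T), discrete_base G) ->
  metrizable R T.
Proof.
move=> regT [J [I [G /discrete_base_nat[H bH]]]].
exact: metrizable_of_discrete_base bH regT T0.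
Qed.

Lemma metrizable_of_csbar : regular_space T -> seq_bases T ->
  has_expanded_network T -> has_countable_lu_csbar_star_star_netbase T ->
  metrizable R T.
Proof.
move=> regT baseT netT [Es [Bs [nb cEs lu]]].
have [e eEs] := countable_enum set0 cEs.
apply: metrizable_of_base => //; apply: discrete_base_of_network netT _.
exact: csbar_star_star_quasi_development regT T0 baseT eEs nb lu.
Qed.

Lemma network_of_csbar (J : countType) (I : Type) (F U : J -> I -> set T) :
  regular_space T -> discretely_expanded F U -> expanded_sigma_net F ->
  has_countable_lu_csbar_star_star_netbase T -> has_expanded_network T.
Proof.
move=> regT FU netF [Es [Bs [nb cEs lu]]].
have [e eEs] := countable_enum set0 cEs.
exact: expanded_network_of_netbase regT T0 FU netF nb lu eEs.
Qed.

End Main.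

Theorem theorem6p1 (R : realType) (T : topologicalType)
    (hT0 : @kolmogorov_space T) :
  [<-> metrizable R T;
       [/\ first_countable T, closed_Gdelta_bar T &
           has_countable_lu_cs_star_netbase T];
       [/\ first_countable T, strong_sigma_space T &
           has_countable_lqu_cs_star_netbase T];
       [/\ first_countable T, collectionwise_normal T, Sigma_space T &
           has_countable_lu_cs_star_netbase T];
       M_space T /\ has_countable_lu_csbar_star_star_netbase T;
       [/\ q_space T, collectionwise_normal T, Sigma_space T &
           has_countable_lu_csbar_star_star_netbase T]].
Proof.
have metrizable_M : metrizable R T ->
    M_space T /\ has_countable_lu_csbar_star_star_netbase T.
  move=> /metrizableP[d hd]; split; first exact: metric_M_space hd hT0.
  exact: metric_lu_csbar_star_star_netbase hd.
have Gdelta_bar_metrizable : [/\ first_countable T, closed_Gdelta_bar T &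
    has_countable_lu_cs_star_netbase T] -> metrizable R T.
  move=> [/first_countable_seq_bases baseT GT [Es [Bs [nb cEs lu]]]].
  have [e eEs] := countable_enum set0 cEs; have [_ bBs _] := nb.
  have regT := locally_uniform_regular bBs lu.
  by apply: metrizable_of_base => //; exact: discrete_base_of_Gdelta_bar eEs nb lu.
have strong_sigma_metrizable : [/\ first_countable T, strong_sigma_space T &
    has_countable_lqu_cs_star_netbase T] -> metrizable R T.
  move=> [/first_countable_seq_bases baseT sT [Es [Bs [nb cEs lqu]]]].
  have [e eEs] := countable_enum set0 cEs; have [regT _ _] := sT.
  apply: metrizable_of_base => //.
  apply: discrete_base_of_network (strong_sigma_expanded_network sT) _.
  exact: cs_star_quasi_development regT hT0 baseT eEs nb lqu.
have Sigma_metrizable : [/\ first_countable T, collectionwise_normal T, Sigma_space T &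
    has_countable_lu_cs_star_netbase T] -> metrizable R T.
  move=> [/first_countable_seq_bases baseT cwn ST [Es [Bs [nb cEs lu]]]].
  have [regT _ _] := ST; have [F [U [FU netF]]] := Sigma_space_expanded_net cwn ST.
  have nbT : has_countable_lu_csbar_star_star_netbase T.
    exists Es, Bs; split=> //; exact: csbar_of_cs_netbase nb.
  apply: metrizable_of_csbar => //.
  exact (network_of_csbar hT0 regT FU netF nbT).
have M_metrizable : M_space T /\ has_countable_lu_csbar_star_star_netbase T ->
    metrizable R T.
  move=> [[regT _ [Us [cU sU aU]]] nbT].
  have [J [I [F [U [FU netF]]]]] := M_space_expanded_net cU sU aU.
  have netT := network_of_csbar hT0 regT FU netF nbT.
  apply: metrizable_of_csbar => //; apply: q_space_seq_bases => //.
  exact: M_space_q_space cU sU aU.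
have q_Sigma_metrizable : [/\ q_space T, collectionwise_normal T, Sigma_space T &
    has_countable_lu_csbar_star_star_netbase T] -> metrizable R T.
  move=> [qT cwn ST nbT]; have [regT _ _] := ST.
  have [F [U [FU netF]]] := Sigma_space_expanded_net cwn ST.
  have netT := network_of_csbar hT0 regT FU netF nbT.
  by apply: metrizable_of_csbar => //; exact: q_space_seq_bases.
tfae.
- move=> /metrizableP[d hd]; split.
  + exact: metric_first_countable hd.
  + exact: metric_closed_Gdelta_bar hd.
  + exact: metric_lu_cs_star_netbase hd.
- move=> /Gdelta_bar_metrizable/metrizableP[d hd]; split.
  + exact: metric_first_countable hd.
  + exact: metric_strong_sigma_space hd hT0.
  + exact: metric_lqu_cs_star_netbase hd.
- move=> /strong_sigma_metrizable/metrizableP[d hd]; split.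
  + exact: metric_first_countable hd.
  + exact: metric_collectionwise_normal hd.
  + exact: metric_Sigma_space hd hT0.
  + exact: metric_lu_cs_star_netbase hd.
- by move=> /Sigma_metrizable/metrizable_M.
- move=> MT; have /metrizableP[d hd] := M_metrizable MT; split.
  + by have [[_ _ [Us [cU sU aU]]] _] := MT; exact: M_space_q_space cU sU aU.
  + exact: metric_collectionwise_normal hd.
  + exact: metric_Sigma_space hd hT0.
  + exact: metric_lu_csbar_star_star_netbase hd.
- exact: q_Sigma_metrizable.
Qed.
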